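(* Let $R$ be a right CF ring. If the Jacobson radical of $R/Z(R_R)$ is completely right T-nilpotent, then $R$ is right artinian. In particular, if $R$ is a right FGF ring such that the Jacobson radical of $R/Z(R_R)$ is completely right T-nilpotent, then $R$ is QF.
   Context: All rings are associative with identity; $R_R$ denotes $R$ as a right module over itself. $R$ is right CF (resp. right FGF) if every cyclic (resp. every finitely generated) right $R$-module embeds in a free right $R$-module. $Z(R_R)$ is the right singular ideal of $R$ (elements with essential right annihilator). An ideal $I$ of a ring is right T-nilpotent if for every infinite sequence $r_1,r_2,\ldots$ of elements of $I$ there exists $n_0\geq 1$ such that $r_{n_0}\cdots r_2 r_1=0$. The Jacobson radical of a ring $S$ is completely right T-nilpotent if every ring $S'$ which is a homomorphic image of $S$ has right T-nilpotent Jacobson radical. $R$ is quasi-Frobenius (QF) if it is right self-injective, $R_R$ is a cogenerator of the category of right $R$-modules, and $R$ is right (and left) artinian. *)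

(* Defs.v *)
From HB Require Import structures.
From mathcomp Require Import all_boot all_order all_algebra.
From mathcomp Require Import boolp.

Set Implicit Arguments.
Unset Strict Implicit.
Unset Printing Implicit Defensive.

Import GRing.Theory.
Local Open Scope ring_scope.
Local Open Scope quotient_scope.

(* Rings are [pzRingType]s: associative and unital, not necessarily
   commutative, the zero ring being allowed.

   A right [R]-module is a left module over the converse ring [R^c]: the
   scaling [r *: m] of an [lmodType R^c] is the right action [m . r].  The
   notions below are stated for left modules over an arbitrary ring and are
   instantiated at [R^c] to obtain their right-handed versions. *)
Notation rmodType R := (lmodType (R^c)).

(* R_R; here [r *: x] is convertible to the product [x * r] of [R]. *)
Notation right_regular R := ((R^c)^o).

Section Modules.
Variable R : pzRingType.
Implicit Types V W F : lmodType R.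

Definition cyclic_module V : Prop :=
  exists v : V, forall x : V, exists r : R, x = r *: v.

Definition finitely_generated_module V : Prop :=
  exists (n : nat) (g : 'I_n -> V),
    forall x : V, exists r : 'I_n -> R, x = \sum_(i < n) r i *: g i.

(* The family [b] is a basis of [F]: it is linearly independent and it spans
   [F], all linear combinations being finite. *)
Definition is_basis F (I : choiceType) (b : I -> F) : Prop :=
  (forall (s : seq I) (r : I -> R), uniq s ->
     \sum_(i <- s) r i *: b i = 0 -> forall i, i \in s -> r i = 0)
  /\ (forall x : F, exists (s : seq I) (r : I -> R),
        x = \sum_(i <- s) r i *: b i).

Definition free_module F : Prop :=
  exists (I : choiceType) (b : I -> F), is_basis b.

Definition embeds_in_free V : Prop :=
  exists F, free_module F /\ exists f : {linear V -> F}, injective f.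

Definition injective_module V : Prop :=
  forall (A B : lmodType R) (i : {linear A -> B}) (f : {linear A -> V}),
    injective i -> exists g : {linear B -> V}, forall a : A, g (i a) = f a.

(* [Hom(-, C)] is faithful. *)
Definition cogenerator (C : lmodType R) : Prop :=
  forall (V W : lmodType R) (f g : {linear V -> W}),
    ~ f =1 g -> exists h : {linear W -> C}, ~ h \o f =1 h \o g.

Definition artinian_module V : Prop :=
  forall N : nat -> {pred V},
    (forall n, submod_closed (N n)) ->
    (forall n, {subset N n.+1 <= N n}) ->
    exists n0, forall n, (n0 <= n)%N -> N n =i N n0.

Definition essential_submodule V (E : {pred V}) : Prop :=
  submod_closed E /\
  forall N : {pred V}, submod_closed N -> (exists2 x, x \in N & x != 0) ->
    exists x, [/\ x \in E, x \in N & x != 0].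

Definition maximal_submodule V (M : {pred V}) : Prop :=
  [/\ submod_closed M,
      exists x, x \notin M &
      forall N : {pred V}, submod_closed N -> {subset M <= N} ->
        N =i M \/ N =i predT].

End Modules.

Section Rings.
Variable R : pzRingType.

Definition right_CF : Prop :=
  forall V : rmodType R, cyclic_module V -> embeds_in_free V.

Definition right_FGF : Prop :=
  forall V : rmodType R, finitely_generated_module V -> embeds_in_free V.

Definition right_artinian : Prop := artinian_module (right_regular R).

Definition left_artinian : Prop := artinian_module R^o.

Definition quasi_Frobenius : Prop :=
  [/\ injective_module (right_regular R),
      cogenerator (right_regular R),
      right_artinian & left_artinian].

Definition jacobson_radical : {pred R} :=
  [pred x : R | `[< forall M : {pred right_regular R},
                      maximal_submodule M -> x \in M >]].

Definition right_annihilator (x : R) : {pred right_regular R} :=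
  [pred r : R | x * r == 0].

(* Z(R_R) *)
Definition right_singular_ideal : {pred R} :=
  [pred x : R | `[< essential_submodule (right_annihilator x) >]].

Definition right_T_nilpotent (I : {pred R}) : Prop :=
  forall r : nat -> R, (forall i, (1 <= i)%N -> r i \in I) ->
    exists2 n0, (1 <= n0)%N & \prod_(i < n0) r (n0 - i)%N = 0.

End Rings.

Arguments jacobson_radical R : clear implicits.
Arguments right_singular_ideal R : clear implicits.

Definition completely_right_T_nilpotent_radical (S : pzRingType) : Prop :=
  forall (S' : pzRingType) (f : {rmorphism S -> S'}),
    (forall y : S', exists x : S, f x = y) ->
    right_T_nilpotent (jacobson_radical S').

Section SingularQuotient.
Variable R : pzRingType.
Local Notation Z := (right_singular_ideal R).

Lemma right_annihilator_submod (x : R) :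
  submod_closed (right_annihilator x).
Proof.
split=> [|a u v]; rewrite !inE ?mulr0 // => /eqP xu /eqP xv.
by rewrite mulrDr xv addr0 [a *: u](erefl : _ = (u : R) * a) mulrA xu mul0r.
Qed.

Lemma right_singularP (x : R) :
  (forall N : {pred right_regular R}, submod_closed N ->
     (exists2 a, a \in N & a != 0) ->
     exists a : R, [/\ x * a = 0, a \in N & a != 0]) <-> x \in Z.
Proof.
split=> [H|/asboolP[_ H] N sN N0].
  apply/asboolP; split=> [|N sN N0]; first exact: right_annihilator_submod.
  by have [a [xa aN a0]] := H N sN N0; exists a; split=> //; apply/eqP.
by have [a [/eqP xa aN a0]] := H N sN N0; exists a.
Qed.

Lemma right_singular_mull (r x : R) : x \in Z -> r * x \in Z.
Proof.
move=> /right_singularP Hx; apply/right_singularP => N sN N0.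
have [a [xa aN a0]] := Hx N sN N0; exists a; split=> //.
by rewrite -mulrA xa mulr0.
Qed.

Lemma right_singular_mulr (x r : R) : x \in Z -> x * r \in Z.
Proof.
move=> /right_singularP Hx; apply/right_singularP => N sN [b bN b0].
have [rN|] := pselect (exists2 a, a \in N & r * (a : R) != 0); last first.
  move=> nrN; exists b; split=> //; rewrite -mulrA.
  have [->|rb0] := eqVneq (r * (b : R)) 0; first by rewrite mulr0.
  by case: nrN; exists b.
pose rNp : {pred right_regular R} :=
  [pred y : R | `[< exists2 a, a \in N & y = r * (a : R) >]].
have srN : submod_closed rNp.
  split; first by apply/asboolP; exists 0; [case: sN | rewrite mulr0].
  move=> c u v /asboolP[a aN ->] /asboolP[a' a'N ->]; apply/asboolP.
  exists (c *: a + a'); first by case: sN => _; apply.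
  by rewrite mulrDr mulrA.
have [|y [xy /asboolP[a aN ydef] y0]] := Hx rNp srN.
  by have [a aN ra0] := rN; exists (r * (a : R)) => //; apply/asboolP; exists a.
exists a; split=> //; first by rewrite -mulrA -ydef.
by apply: contraNneq y0 => a0; rewrite ydef a0 mulr0.
Qed.

Lemma right_singular_zmod_closed : zmod_closed Z.
Proof.
split=> [|x y /right_singularP Hx /right_singularP Hy].
  apply/right_singularP => N sN [a aN a0]; exists a; split=> //.
  by rewrite mul0r.
apply/right_singularP => N sN N0.
pose Ny : {pred right_regular R} :=
  [pred a | (a \in N) && (a \in right_annihilator y)].
have sNy : submod_closed Ny.
  have [N0' Nl] := sN; have [A0 Al] := right_annihilator_submod y.
  split; first by apply/andP.
  move=> c u v /andP[uN uA] /andP[vN vA]; apply/andP.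
  by split; [apply: Nl | apply: Al].
have [|a [xa /andP[aN /eqP ya] a0]] := Hx Ny sNy.
  have [b [yb bN b0]] := Hy N sN N0; exists b => //; apply/andP; split=> //.
  exact/eqP.
by exists a; split=> //; rewrite mulrBl xa ya subr0.
Qed.

HB.instance Definition _ :=
  GRing.isZmodClosed.Build R (right_singular_ideal R)
    right_singular_zmod_closed.

(* R / Z(R_R).  The library provides the additive group of this quotient; the
   ring structure is only available there for commutative rings. *)
Definition singular_quotient : Type := Quotient.quot (right_singular_ideal R).

HB.instance Definition _ := GRing.Zmodule.on singular_quotient.
HB.instance Definition _ := Quotient.on singular_quotient.

Local Notation pi := (\pi_singular_quotient).

Definition singular_quotient_one : singular_quotient := pi 1.
Definition singular_quotient_mul (x y : singular_quotient) : singular_quotient :=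
  pi (repr x * repr y).

Local Notation one := singular_quotient_one.
Local Notation mul := singular_quotient_mul.

Lemma singular_quotient_eq (x y : R) :
  (pi x = pi y :> singular_quotient) <-> (x - y \in Z).
Proof. by rewrite Quotient.idealrBE; split=> /eqP. Qed.

Lemma pi_singular_mul (x y : R) : mul (pi x) (pi y) = pi (x * y).
Proof.
apply/singular_quotient_eq.
rewrite /singular_quotient_mul; set x' := repr _; set y' := repr _.
have xx' : x' - x \in Z by apply/singular_quotient_eq; rewrite reprK.
have yy' : y' - y \in Z by apply/singular_quotient_eq; rewrite reprK.
have -> : x' * y' - x * y = (x' - x) * y' + x * (y' - y).
  by rewrite mulrBl mulrBr addrA subrK.
by apply: rpredD; [apply: right_singular_mulr | apply: right_singular_mull].
Qed.

Let mulA : associative mul.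
Proof.
elim/quotW=> x; elim/quotW=> y; elim/quotW=> z.
by rewrite (pi_singular_mul y z) (pi_singular_mul x y) !pi_singular_mul mulrA.
Qed.

Let mul1 : left_id one mul.
Proof. by elim/quotW=> x; rewrite pi_singular_mul mul1r. Qed.

Let mul_1 : right_id one mul.
Proof. by elim/quotW=> x; rewrite pi_singular_mul mulr1. Qed.

Let piD (x y : R) : pi (x + y) = pi x + pi y :> singular_quotient.
Proof. exact: Quotient.pi_add. Qed.

Let mulDl : left_distributive mul +%R.
Proof.
elim/quotW=> x; elim/quotW=> y; elim/quotW=> z.
rewrite -piD (pi_singular_mul x z) (pi_singular_mul y z).
by rewrite pi_singular_mul mulrDl piD.
Qed.

Let mulDr : right_distributive mul +%R.
Proof.
elim/quotW=> x; elim/quotW=> y; elim/quotW=> z.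
rewrite -piD (pi_singular_mul x y) (pi_singular_mul x z).
by rewrite pi_singular_mul mulrDr piD.
Qed.

HB.instance Definition _ :=
  GRing.Zmodule_isPzRing.Build singular_quotient mulA mul1 mul_1 mulDl mulDr.

End SingularQuotient.

(* Main.v *)
Require Import Defs.
From HB Require Import structures.
From mathcomp Require Import all_boot all_order all_algebra.
From mathcomp Require Import boolp classical_sets functions cardinality.

(* In a right CF ring every right ideal is the right annihilator of a finite set,
   and every simple right module embeds in R.  Put S = R / Z(R_R); S acts on the
   left of the right socle, which Z(R_R) annihilates.  For two-sided ideals
   Z(R_R) <= K1 < K2 such that each a in K2 \ K1 has a multiple b a outside K1 with
   b in K2, the ideal K2 / K1 of R / K1 is not right T-nilpotent, so some simple
   right module is annihilated by K1 but not by K2.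

   For a set B of isomorphism types of simple right modules let K_B be the
   annihilator of the homogeneous components of types outside B; it contains a
   finite set with no common zero on the other components, and
   K_B K_B' <= K_(B cap B').  If there were infinitely many types, an independent
   family of 2^kappa sets of types (kappa being the number of types) would yield
   2^kappa distinct simple modules.  So there are finitely many types t, and
   t |-> (a simple module annihilated by K_0 but not by K_t) is a permutation of
   them.  An infinitely generated homogeneous component, or a nonessential socle,
   would yield one simple module too many.  Hence the right socle is finitely
   generated and essential; the cyclic modules, being embedded in some R^n, are
   finitely cogenerated, and R is right artinian.

   In the FGF case the same permutation shows that a left ideal with zero right
   annihilator is R.  If f : I -> R is linear on a right ideal, the pushout of
   I -> R along f embeds in some R^n, giving u f(a) = v a with r(u) = 0; a left
   inverse of the column u extends f, so R is right self-injective by Baer's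
   criterion.  Then every left ideal is a left annihilator and, R being right
   noetherian, R is left artinian. *)

Set Implicit Arguments.
Unset Strict Implicit.
Unset Printing Implicit Defensive.

Import GRing.Theory.
Local Open Scope ring_scope.
Local Open Scope quotient_scope.
Local Open Scope classical_set_scope.

(** * Infinite sets *)

(** Zorn's lemma for graphs of partial bijections between [A] and [B]: by [ext], a maximal graph
    exhausts [A] or [B]. *)
Lemma set_comparable (X : Type) (A B : set X) :
  (exists f : X -> X, {homo f : x / A x >-> B x} /\
     forall x y, A x -> A y -> f x = f y -> x = y) \/
  (exists f : X -> X, {homo f : x / B x >-> A x} /\
     forall x y, B x -> B y -> f x = f y -> x = y).
Proof.
pose P (G : set (X * X)) := (forall p, G p -> A p.1 /\ B p.2) /\
  forall p q, G p -> G q -> p.1 = q.1 <-> p.2 = q.2.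
have [F sFP totF|G [[GAB Gf] Gmax]] := @Zorn_bigcup _ P.
  split=> [p [H FH Hp]|p q [H FH Hp] [H' FH' Hq]].
    by have [+ _] := sFP _ FH; apply.
  have [HH|HH] := totF _ _ FH FH'.
    by have [_ +] := sFP _ FH'; apply => //; apply: HH.
  by have [_ +] := sFP _ FH; apply => //; apply: HH.
have ext a b : A a -> B b -> (exists2 p, G p & p.1 = a) \/ (exists2 p, G p & p.2 = b).
  move=> Aa Bb; apply: contrapT => /not_orP[na nb].
  apply: (Gmax (fun p => G p \/ p = (a, b))).
    split; first by move=> p Gp; left.
    by move=> /(_ (a, b) (or_intror erefl)) Gab; case: na; exists (a, b).
  split=> [p [/GAB//|->//]|p q [Gp|->] [Gq|->] //=]; first exact: Gf.
    by split=> pe; [case: na|case: nb]; exists p.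
  by split=> pe; [case: na|case: nb]; exists q.
have [domA|/existsNP[a /not_implyP[Aa na]]] :=
  pselect (forall a, A a -> exists2 p, G p & p.1 = a).
- have /choice[f fP] a : exists b, A a -> G (a, b).
    have [/domA[[a' b] Gp /= <-]|na] := pselect (A a); first by exists b.
    by exists a.
  left; exists f; split=> [x /fP/GAB[]//|x y /fP Gx /fP Gy fxy].
  exact/(Gf _ _ Gx Gy).
- have domB b : B b -> exists2 p, G p & p.2 = b by move=> /(ext _ _ Aa)[].
  have /choice[f fP] b : exists a, B b -> G (a, b).
    have [/domB[[a' b'] Gp /= <-]|nb] := pselect (B b); first by exists a'.
    by exists b.
  right; exists f; split=> [x /fP/GAB[]//|x y /fP Gx /fP Gy fxy].
  exact/(Gf _ _ Gx Gy).
Qed.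

(* Hessenberg: an infinite set is equipotent to its square.  One extends by
   Zorn's lemma the pairing function of a countable subset. *)
Section Pairing.
Variables (X : Type) (i : nat -> X).
Hypothesis injI : injective i.

(** A partial pairing is given by its graph and its carrier is read off the diagonal; [good G] says
    that [G] is an injective operation on the carrier [dom G]. *)
Let dom (G : set ((X * X) * X)) : set X := fun a => exists c, G ((a, a), c).

Let good (G : set ((X * X) * X)) := [/\
  forall p c, G (p, c) -> [/\ dom G p.1, dom G p.2 & dom G c],
  forall a b, dom G a -> dom G b -> exists c, G ((a, b), c) &
  forall p c q d, G (p, c) -> G (q, d) -> p = q <-> c = d].

Let G0 : set ((X * X) * X) :=
  fun p => exists m n, p = ((i m, i n), i (pickle (m, n))).

Let dom0 m : dom G0 (i m).
Proof. by exists (i (pickle (m, m))), m, m. Qed.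

Let good0 : good G0.
Proof.
split=> [p c [m [n [-> ->]]]|a b [c [m [m' [-> _ _]]]] [d [n [n' [-> _ _]]]]|].
- by split; apply: dom0.
- by exists (i (pickle (m, n))), m, n.
- move=> p c q d [m [n [-> ->]]] [m' [n' [-> ->]]]; split.
    by move=> [/injI -> /injI ->].
  by move=> /injI/(pcan_inj (@pickleK _))[-> ->].
Qed.

Let domS (G H : set ((X * X) * X)) : G `<=` H -> dom G `<=` dom H.
Proof. by move=> GH a [c /GH Hc]; exists c. Qed.

(** Adjoining [G0] to each member makes the property hold for the empty chain as well. *)
Let good_union (F : set (set ((X * X) * X))) :
  F `<=` (fun G => good (G `|` G0)) -> total_on F subset ->
  good (\bigcup_(G in F) G `|` G0).
Proof.
move=> Fgood totF; set U := _ `|` _.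
have common p q : U p -> U q -> exists H, [/\ good H, H `<=` U, H p & H q].
  have HU H : F H -> H `|` G0 `<=` U.
    by move=> FH r [Hr|]; [left; exists H | right].
  move=> [[H FH Hp]|p0] [[H' FH' H'q]|q0]; last by
    exists G0; split; [exact: good0|move=> r; right|exact: p0|exact: q0].
  - have [HH|HH] := totF _ _ FH FH'.
      exists (H' `|` G0); split; [exact: Fgood|exact: HU|left|left] => //.
      exact: HH.
    exists (H `|` G0); split; [exact: Fgood|exact: HU|left|left] => //.
    exact: HH.
  - by exists (H `|` G0); split; [exact: Fgood|exact: HU|left|right].
  - by exists (H' `|` G0); split; [exact: Fgood|exact: HU|right|left].
split=> [p c Upc|a b [c Uac] [d Ubd]|p c q d Up Uq].
- have [H [[gH _ _] /domS HU Hpc _]] := common _ _ Upc Upc.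
  by have [*] := gH _ _ Hpc; split; apply: HU.
- have [H [[_ gH _] HU Ha Hb]] := common _ _ Uac Ubd.
  have [e He] := gH a b (ex_intro _ _ Ha) (ex_intro _ _ Hb).
  by exists e; apply: HU.
- by have [H [[_ _ gH] HU Ha Hb]] := common _ _ Up Uq; apply: gH.
Qed.

Lemma pairing : exists f : X -> X -> X,
  forall a b c d, f a b = f c d -> a = c /\ b = d.
Proof.
have [G [gA Amax]] := Zorn_bigcup good_union.
have {gA Amax}[G1 [G0G1 gG Gmax]] : exists G1, [/\ G0 `<=` G1, good G1 &
    forall H, G1 `<` H -> ~ good H].
  exists (G `|` G0); split; [by move=> x; right|exact: gA|].
  move=> H [GH nHG]; have -> : H = H `|` G0.
    by apply/seteqP; split=> [x ?|x [//|?]]; [left|apply: GH; right].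
  apply: Amax; split; first by move=> x Gx; apply: GH; left.
  by move=> HG; apply: nHG => x /HG; left.
move: G1 G0G1 gG Gmax => {}G G0G [Gdom Gtot Ginj] Gmax.
have domG0 m : dom G (i m) by apply: domS (dom0 m).
have /choice[f1 f1P] (p : X * X) : exists c, dom G p.1 -> dom G p.2 -> G (p, c).
  have [[p1 p2]|np] := pselect (dom G p.1 /\ dom G p.2).
    by have [c] := Gtot _ _ p1 p2; exists c; rewrite [p]surjective_pairing.
  by exists (i 0%N) => p1 p2; case: np.
pose f a b := f1 (a, b).
have fP a b : dom G a -> dom G b -> G ((a, b), f a b).
  by move=> ? ?; apply: f1P.
have fD a b : dom G a -> dom G b -> dom G (f a b).
  by move=> Da Db; have [] := Gdom _ _ (fP _ _ Da Db).
have fI a b c d : dom G a -> dom G b -> dom G c -> dom G d ->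
    f a b = f c d -> a = c /\ b = d.
  move=> Da Db Dc Dd e.
  by have /(Ginj _ _ _ _ (fP _ _ Da Db) (fP _ _ Dc Dd))[-> ->] := e.
have [[g [gC gI]]|[k [kD kI]]] := set_comparable (dom G) (~` dom G).
  (* Here the carrier can be doubled: [h] names the elements of [dom G] and of its copy by [g].
     Pairs that are not both old get values in that copy, and the labels [e s t] keep the three new
     blocks apart. This contradicts maximality. *)
  exfalso; pose h a (s : bool) := if s then g a else a.
  have hI a s b t : dom G a -> dom G b -> h a s = h b t -> a = b /\ s = t.
    move=> Da Db; case: s t => [] [] /=.
    - by move=> /gI-> //.
    - by move=> e; have := gC _ Da; rewrite e.
    - by move=> e; have := gC _ Db; rewrite -e.
    - by [].
  pose e (s t : bool) := i (s + t.*2)%N.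
  have eI s t s' t' : e s t = e s' t' -> s = s' /\ t = t'.
    by move=> /injI; case: s t s' t' => [] [] [] [].
  have De s t : dom G (e s t) by exact: domG0.
  pose H (x : (X * X) * X) := G x \/ exists a s b t,
    [/\ dom G a, dom G b, s || t & x = ((h a s, h b t), g (f (e s t) (f a b)))].
  have GH : G `<=` H by move=> x; left.
  have gDH a : dom G a -> dom H (g a).
    move=> Da; exists (g (f (e true true) (f a a))); right.
    by exists a, true, a, true.
  have hDH a s : dom G a -> dom H (h a s).
    by case: s => Da; [exact: gDH | exact: domS Da].
  have DHh x : dom H x -> exists a s, dom G a /\ x = h a s.
    case=> c [Gx|[a [s [b [t [Da _ _ [-> _ _]]]]]]]; last by exists a, s.
    by exists x, false; split=> //; exists c.
  apply: (Gmax H).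
    split=> // HG; have := domS HG (gDH _ (domG0 0%N)).
    exact: (gC _ (domG0 0%N)).
  split.
  - move=> p c [/Gdom[]|]; first by move=> *; split; apply: domS GH _ _.
    move=> [a [s [b [t [Da Db st [-> ->]]]]]]; split; [exact: hDH|exact: hDH|].
    by apply/gDH/fD => //; apply: fD.
  - move=> _ _ /DHh[a [s [Da ->]]] /DHh[b [t [Db ->]]].
    case: (boolP (s || t)) => [st|/norP[/negbTE-> /negbTE->]] /=.
      by exists (g (f (e s t) (f a b))); right; exists a, s, b, t.
    by exists (f a b); left; apply: fP.
  - have old_new p c q d : G (p, c) -> (exists a s b t,
        [/\ dom G a, dom G b, s || t &
            (q, d) = ((h a s, h b t), g (f (e s t) (f a b)))]) ->
        p <> q /\ c <> d.
      move=> Gpc [a [s [b [t [Da Db st [-> ->]]]]]]; split=> ec.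
        have [D1 D2 _] := Gdom _ _ Gpc; rewrite ec /= in D1 D2.
        case: s t st D1 D2 {ec} => [] [] //= _ Dg Dh; [exact: gC Dg|exact: gC Dg|].
        exact: gC Dh.
      have [_ _] := Gdom _ _ Gpc; rewrite ec.
      by apply: (gC (f (e s t) (f a b))); apply: (fD) => //; apply: (fD).
    move=> p c q d [Gp|Np] [Gq|Nq]; first exact: Ginj.
    + by have [] := old_new _ _ _ _ Gp Nq.
    + have [n1 n2] := old_new _ _ _ _ Gq Np.
      by split=> ?; [case: n1|case: n2].
    + move: Np Nq => [a [s [b [t [Da Db st [-> ->]]]]]].
      move=> [a' [s' [b' [t' [Da' Db' st' [-> ->]]]]]]; split.
        by move=> [/hI[]// -> -> /hI[]// -> ->].
      have Dab := fD _ _ Da Db; have Dab' := fD _ _ Da' Db'.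
      move=> /(gI _ _ (fD _ _ (De s t) Dab) (fD _ _ (De s' t') Dab')).
      move=> /(fI _ _ _ _ (De s t) Dab (De s' t') Dab')[/eI[-> ->]].
      by move=> /fI[]// -> ->.
(* Here the complement injects into [dom G], so [u] injects all of [X] into [dom G]; the labels
   [i 0] and [i 1] separate the two pieces. *)
pose u x := if pselect (dom G x) then f (i 0%N) x else f (i 1%N) (k x).
have uD x : dom G (u x).
  by rewrite /u; case: pselect => Dx; apply: fD => //; apply: kD.
have uI x y : u x = u y -> x = y.
  rewrite /u; case: pselect => Dx; case: pselect => Dy.
  - by move=> /fI[].
  - by move=> /fI[]//; [exact: kD|move/injI].
  - by move=> /fI[]//; [exact: kD|move/injI].
  - by move=> /fI[]//; [exact: kD|exact: kD|move=> _ /kI->].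
by exists (fun a b => f (u a) (u b)) => a b c d /fI[]// /uI-> /uI->.
Qed.

(** Lists are coded by iterated pairing; the first component is [i 0] for the empty list and [i 1]
    otherwise. *)
Lemma seq_bool_embedding : exists g : seq (X * bool) -> X, injective g.
Proof.
have [f fI] := pairing.
pose g := foldr (fun (p : X * bool) a => f (i 1%N) (f p.1 (f (i p.2) a)))
  (f (i 0%N) (i 0%N)).
exists g; elim=> [|[x b] s IH] [|[y c] t] //=.
- by move=> /fI[/injI].
- by move=> /fI[/injI].
- by move=> /fI[_ /fI[-> /fI[/injI bc /IH->]]]; case: b c bc => [] [].
Qed.

End Pairing.

Lemma no_powerset_embedding (X : Type) (g : set X -> X) : ~ injective g.
Proof.
move=> gI; pose D : set X := fun x => exists2 Y, x = g Y & ~ Y x.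
have [DD|nDD] := pselect (D (g D)); last by apply: (nDD); exists D.
by have [Y e nY] := DD; apply: nY; rewrite -(gI _ _ e).
Qed.

(** Hausdorff's independent families, in a weak form: no member is covered by finitely many others.
    [Y] differs from each set in [l] at some point, and a finite description of [Y] can record all
    these points. *)
Lemma independent_family (X : Type) (i : nat -> X) : injective i ->
  exists A : set X -> set X, forall Y (l : seq (set X)), Y \notin l ->
    exists2 x, A Y x & forall Z, Z \in l -> ~ A Z x.
Proof.
move=> iI; have [g gI] := seq_bool_embedding iI.
pose desc (Y : set X) := foldr (fun p : X * bool => and (p.2 <-> Y p.1)) True.
(* The members of [A Y] code the finite partial descriptions of [Y]. *)
exists (fun Y x => exists2 s, desc Y s & x = g s) => Y l Yl.
suff [s dY ds] : exists2 s, desc Y s & forall Z, Z \in l -> ~ desc Z s.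
  exists (g s); first by exists s.
  by move=> Z Zl [t dt /gI e]; apply: (ds Z) => //; rewrite e.
elim: l Yl => [|Z l IH]; first by exists [::].
rewrite in_cons negb_or => /andP[/eqP YZ /IH[s dY ds]].
have [x Hx] : exists x, ~ (Y x <-> Z x).
  apply: contrapT => /forallNP H; apply: YZ.
  by apply/funext => x; apply/propext; apply: contrapT.
exists ((x, `[< Y x >]) :: s); first by split=> //; split=> /asboolP.
move=> Z'; rewrite in_cons => /predU1P[->|/ds dZ'] [/= dx //].
by move=> _; apply: Hx; split=> [/asboolP/dx|/dx/asboolP].
Qed.

(** * Quotient modules and quotient rings *)

Section QuotientModule.
Variables (K : pzRingType) (V : lmodType K) (P : {pred V}).
Hypothesis sP : submod_closed P.

(** A copy of [P] that carries its closure proof, so that the subgroup structure can be attached to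
    the term. *)
Definition submod_pred of submod_closed P : {pred V} := P.

Let zmodP : zmod_closed (submod_pred sP).
Proof.
have [P0 PD] := sP; split=> // x y Px Py.
by rewrite -[- y]scaleN1r addrC; apply: PD.
Qed.

HB.instance Definition _ :=
  GRing.isZmodClosed.Build V (submod_pred sP) zmodP.

Definition quotient_module : Type := Quotient.quot (submod_pred sP).

HB.instance Definition _ := GRing.Zmodule.on quotient_module.
HB.instance Definition _ := Quotient.on quotient_module.

Local Notation pi := (\pi_quotient_module).

Lemma quotient_module_eq (x y : V) :
  (pi x = pi y :> quotient_module) <-> (x - y \in P).
Proof. by rewrite -[P]/(submod_pred sP) Quotient.idealrBE; split=> /eqP. Qed.

Lemma pi_module_add (x y : V) : pi (x + y) = pi x + pi y :> quotient_module.
Proof. exact: Quotient.pi_add. Qed.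

Definition quotient_module_scale (a : K) (x : quotient_module) :
  quotient_module := pi (a *: repr x).

Lemma pi_module_scale (a : K) (x : V) :
  quotient_module_scale a (pi x) = pi (a *: x).
Proof.
apply/quotient_module_eq; rewrite -scalerBr; have [P0 PD] := sP.
rewrite -[_ *: _]addr0; apply: PD => //.
by apply/quotient_module_eq; rewrite reprK.
Qed.

Let scaleA a b v : quotient_module_scale a (quotient_module_scale b v) =
  quotient_module_scale (a * b) v.
Proof. by elim/quotW: v => v; rewrite (pi_module_scale b v) !pi_module_scale scalerA. Qed.

Let scale1 : left_id 1 quotient_module_scale.
Proof. by elim/quotW=> v; rewrite pi_module_scale scale1r. Qed.

Let scaleDr : right_distributive quotient_module_scale +%R.
Proof.
move=> a; elim/quotW=> u; elim/quotW=> v.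
rewrite -pi_module_add (pi_module_scale a u) (pi_module_scale a v).
by rewrite pi_module_scale scalerDr pi_module_add.
Qed.

Let scaleDl v : {morph quotient_module_scale^~ v : a b / a + b}.
Proof.
elim/quotW: v => v a b.
rewrite (pi_module_scale a v) (pi_module_scale b v).
by rewrite pi_module_scale scalerDl pi_module_add.
Qed.

HB.instance Definition _ := GRing.Zmodule_isLmodule.Build K quotient_module
  scaleA scale1 scaleDr scaleDl.

Lemma pi_moduleZ (a : K) (x : V) : pi (a *: x) = a *: pi x :> quotient_module.
Proof. by rewrite -pi_module_scale. Qed.

Lemma pi_module_eq0 (x : V) : (pi x = 0 :> quotient_module) <-> x \in P.
Proof.
have <- : pi 0 = 0 :> quotient_module.
  by rewrite -[RHS](scale0r (pi 0)) -pi_moduleZ scale0r.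
by rewrite quotient_module_eq subr0.
Qed.

End QuotientModule.

Definition two_sided (R : pzRingType) (I : set R) :=
  [/\ I 0, forall x y, I x -> I y -> I (x - y),
      forall r x, I x -> I (r * x) & forall x r, I x -> I (x * r)].

Section QuotientRing.
Variables (R : pzRingType) (I : set R).
Hypothesis sI : two_sided I.

Definition ideal_pred of two_sided I : {pred R} := [pred x | `[< I x >]].

Let zmodI : zmod_closed (ideal_pred sI).
Proof.
have [I0 IB _ _] := sI; split; first exact/asboolP.
by move=> x y /asboolP Ix /asboolP Iy; apply/asboolP/IB.
Qed.

HB.instance Definition _ :=
  GRing.isZmodClosed.Build R (ideal_pred sI) zmodI.

Definition quotient_ring : Type := Quotient.quot (ideal_pred sI).

HB.instance Definition _ := GRing.Zmodule.on quotient_ring.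
HB.instance Definition _ := Quotient.on quotient_ring.

Local Notation pi := (\pi_quotient_ring).

Lemma quotient_ring_eq (x y : R) : (pi x = pi y :> quotient_ring) <-> I (x - y).
Proof.
have -> : I (x - y) <-> x - y \in ideal_pred sI by split=> /asboolP.
by rewrite Quotient.idealrBE; split=> /eqP.
Qed.

Lemma pi_ring_add (x y : R) : pi (x + y) = pi x + pi y :> quotient_ring.
Proof. exact: Quotient.pi_add. Qed.

Definition quotient_ring_mul (x y : quotient_ring) : quotient_ring :=
  pi (repr x * repr y).

Local Notation mul := quotient_ring_mul.

Lemma pi_ring_mul (x y : R) : mul (pi x) (pi y) = pi (x * y).
Proof.
have [I0 IB Il Ir] := sI; apply/quotient_ring_eq.
rewrite /mul; set x' := repr _; set y' := repr _.
have -> : x' * y' - x * y = x * (y' - y) - (x - x') * y'.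
  by rewrite mulrBr mulrBl opprB [RHS]addrC addrA subrK.
by apply: IB; [apply: Il|apply: Ir]; apply/quotient_ring_eq; rewrite reprK.
Qed.

Let mulA : associative mul.
Proof.
by elim/quotW=> x; elim/quotW=> y; elim/quotW=> z; rewrite (pi_ring_mul y z)
  (pi_ring_mul x y) !pi_ring_mul mulrA.
Qed.

Let mul1 : left_id (pi 1) mul.
Proof. by elim/quotW=> x; rewrite pi_ring_mul mul1r. Qed.

Let mul_1 : right_id (pi 1) mul.
Proof. by elim/quotW=> x; rewrite pi_ring_mul mulr1. Qed.

Let mulDl : left_distributive mul +%R.
Proof.
elim/quotW=> x; elim/quotW=> y; elim/quotW=> z.
rewrite -pi_ring_add (pi_ring_mul x z) (pi_ring_mul y z).
by rewrite pi_ring_mul mulrDl pi_ring_add.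
Qed.

Let mulDr : right_distributive mul +%R.
Proof.
elim/quotW=> x; elim/quotW=> y; elim/quotW=> z.
rewrite -pi_ring_add (pi_ring_mul x y) (pi_ring_mul x z).
by rewrite pi_ring_mul mulrDr pi_ring_add.
Qed.

HB.instance Definition _ :=
  GRing.Zmodule_isPzRing.Build quotient_ring mulA mul1 mul_1 mulDl mulDr.

Lemma pi_ringM (x y : R) : pi (x * y) = pi x * pi y :> quotient_ring.
Proof. by rewrite -pi_ring_mul. Qed.

Lemma pi_ring_eq0 (x : R) : (pi x = 0 :> quotient_ring) <-> I x.
Proof.
have <- : pi 0 = 0 :> quotient_ring 
  by apply: (addIr (pi 0)); rewrite -pi_ring_add !add0r.
by rewrite quotient_ring_eq subr0.
Qed.

End QuotientRing.

(** The T-nilpotence hypothesis thereby applies to every factor ring of [R] by an ideal containing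
    Z(R_R). *)
Lemma singular_quotient_onto (R : pzRingType) (I : set R) (sI : two_sided I) :
  (forall z, z \in right_singular_ideal R -> I z) ->
  exists f : {rmorphism singular_quotient R -> quotient_ring sI},
    forall y, exists x, f x = y.
Proof.
move=> ZI; pose p := \pi_(singular_quotient R); pose q := \pi_(quotient_ring sI).
pose f (x : singular_quotient R) : quotient_ring sI := q (repr x).
have fpi x : f (p x) = q x.
  by apply/quotient_ring_eq/ZI/singular_quotient_eq; rewrite reprK.
have fB : zmod_morphism f.
  elim/quotW=> x; elim/quotW=> y.
  have -> : p x - p y = p (x - y).
    by rewrite /p (Quotient.pi_add _ x (- y)) (Quotient.pi_opp _ y).
  by rewrite !fpi /q (Quotient.pi_add _ x (- y)) (Quotient.pi_opp _ y).
have fM : monoid_morphism f.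
  split; first exact: fpi.
  elim/quotW=> x; elim/quotW=> y.
  have -> : p x * p y = p (x * y) by exact: pi_singular_mul.
  by rewrite !fpi /q pi_ringM.
pose add := GRing.isZmodMorphism.Build _ _ f fB.
pose mult := GRing.isMonoidMorphism.Build _ _ f fM.
pose F : {rmorphism singular_quotient R -> quotient_ring sI} :=
  HB.pack f add mult.
by exists F; elim/quotW=> x; exists (p x); apply: fpi.
Qed.

(** * Right ideals as annihilators *)

(** Brings expansions over different lists, possibly with repetitions, to one duplicate-free list,
    where linear independence applies. *)
Lemma sum_uniq_extend (K : pzRingType) (F : lmodType K) (I : eqType)
    (b : I -> F) (s S : seq I) (r : I -> K) : uniq S -> {subset s <= S} ->
  exists c : I -> K, \sum_(i <- s) r i *: b i = \sum_(i <- S) c i *: b i.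
Proof.
move=> uS; elim: s => [_|j s IH sS].
  by exists (fun=> 0); rewrite big_nil big1 // => i _; rewrite scale0r.
have [|c ec] := IH; first by move=> i si; apply: sS; rewrite in_cons si orbT.
have jS : j \in S by apply: sS; rewrite mem_head.
exists (fun i => c i + (if i == j then r j else 0)); rewrite big_cons ec.
under [RHS]eq_bigr => i _ do rewrite scalerDl.
rewrite big_split /= [X in _ = _ + X](bigD1_seq j) //= eqxx.
by rewrite [X in _ + (_ + X)]big1 ?addr0 1?addrC // => i /negbTE->; rewrite scale0r.
Qed.

Lemma free_pair_relations (K : pzRingType) (F : lmodType K) (w1 w2 : F) :
  free_module F -> exists s : seq (K * K), forall a b : K,
    a *: w1 + b *: w2 = 0 <-> forall p, p \in s -> a * p.1 + b * p.2 = 0.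
Proof.
move=> [I [e [efree espan]]].
have [s1 [r1 ->]] := espan w1; have [s2 [r2 ->]] := espan w2.
pose S := undup (s1 ++ s2); have uS : uniq S by apply: undup_uniq.
have [|c1 ->] := @sum_uniq_extend _ _ _ e s1 S r1 uS.
  by move=> i si; rewrite mem_undup mem_cat si.
have [|c2 ->] := @sum_uniq_extend _ _ _ e s2 S r2 uS.
  by move=> i si; rewrite mem_undup mem_cat si orbT.
exists [seq (c1 i, c2 i) | i <- S] => a b.
rewrite !scaler_sumr -big_split /=.
under eq_bigr => i _ do rewrite !scalerA -scalerDl.
split=> [/(efree _ _ uS) H p /mapP[i iS ->]|H]; first exact: H.
rewrite big_seq big1 // => i iS; have /= -> := H (c1 i, c2 i) (map_f _ iS).
by rewrite scale0r.
Qed.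

Section Annihilators.
Variable R : pzRingType.
Implicit Types (I : set R) (x : R).

Definition right_ideal I :=
  [/\ I 0, forall a b, I a -> I b -> I (a + b) & forall a r, I a -> I (a * r)].

Lemma right_idealB I a b : right_ideal I -> I a -> I b -> I (a - b).
Proof. by case=> _ ID IM Ia Ib; rewrite -mulrN1; apply/ID/IM. Qed.

Lemma right_ideal_submod I : right_ideal I ->
  submod_closed ([pred a | `[< I a >]] : {pred right_regular R}).
Proof.
case=> I0 ID IM; split=> [|c a b /asboolP Ia /asboolP Ib]; first exact/asboolP.
by apply/asboolP/ID => //; apply: IM.
Qed.

Lemma submod_right_ideal (N : {pred right_regular R}) : submod_closed N ->
  right_ideal (fun a => a \in N).
Proof.
case=> N0 NZ; split=> // [a b Na Nb|a r Na].
  by have := NZ 1 a b Na Nb; rewrite scale1r.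
by have := NZ r a 0 Na N0; rewrite addr0.
Qed.

(** Embed [R / I] in a free module: [I] is the annihilator of the image of the class of 1, that is,
    of its finitely many coordinates. *)
Lemma CF_annihilator : right_CF R -> forall I, right_ideal I ->
  exists s : seq R, forall a, I a <-> forall x, x \in s -> x * a = 0.
Proof.
move=> CF I rI; pose sP := right_ideal_submod rI.
pose p := \pi_(quotient_module sP).
have [|F [Ffree [f fI]]] := CF (quotient_module sP).
  exists (p 1); elim/quotW=> x; exists x; rewrite -pi_moduleZ; congr (p _).
  exact/esym/(mul1r (x : R)).
have [s Hs] := free_pair_relations (f (p 1)) 0 Ffree.
exists (unzip1 s) => a.
have <- : (a : R^c) *: f (p 1) + (0 : R^c) *: (0 : F) = 0 <-> I a.
  rewrite scaler0 addr0 -linearZ -[X in _ = X](raddf0 f).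
  have -> : (a : R^c) *: p 1 = p a.
    rewrite -pi_moduleZ; congr (p _); exact: (mul1r (a : R)).
  split=> [/fI/(pi_module_eq0 sP)/asboolP//|Ia].
  by congr (f _); apply/(pi_module_eq0 sP)/asboolP.
rewrite (Hs a 0); split=> [H x /mapP[q qs ->]|H q qs].
  by have := H _ qs; rewrite mul0r addr0.
by rewrite mul0r addr0; apply: H; apply: map_f.
Qed.

(** The same argument for a submodule of R^2, whose quotient is generated by the classes of the two
    unit vectors. *)
Lemma FGF_annihilator2 : right_FGF R -> forall I : set (R * R),
  I 0 -> (forall a b, I a -> I b -> I (a + b)) ->
  (forall a r, I a -> I (a.1 * r, a.2 * r)) ->
  exists s : seq (R * R), forall a b,
    I (a, b) <-> forall p, p \in s -> p.1 * a + p.2 * b = 0.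
Proof.
move=> FGF I I0 ID IM; pose V : lmodType R^c := (right_regular R * right_regular R)%type.
have sP : submod_closed ([pred a | `[< I a >]] : {pred V}).
  split=> [|c a b /asboolP Ia /asboolP Ib]; first exact/asboolP.
  by apply/asboolP/ID => //; apply: (IM).
pose p := \pi_(quotient_module sP).
pose e1 : V := (1, 0); pose e2 : V := (0, 1).
have decomp (a b : R) : p (a, b) = (a : R^c) *: p e1 + (b : R^c) *: p e2.
  rewrite -!pi_moduleZ -pi_module_add; congr (p _).
  suff : (a, b) = (1 * a + 0 * b, 0 * a + 1 * b) by [].
  by rewrite !mul1r !mul0r addr0 add0r.
have [|F [Ffree [f fI]]] := FGF (quotient_module sP).
  exists 2, (fun i : 'I_2 => if i == 0 then p e1 else p e2).
  elim/quotW=> -[a b]; exists (fun i : 'I_2 => if i == 0 then a else b).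
  by rewrite big_ord_recl big_ord1 /= -decomp.
have [s Hs] := free_pair_relations (f (p e1)) (f (p e2)) Ffree.
exists s => a b; rewrite -(Hs a b) -!linearZ -raddfD -decomp -[X in _ = X](raddf0 f).
split=> [Iab|/fI/(pi_module_eq0 sP)/asboolP//].
by congr (f _); apply/(pi_module_eq0 sP)/asboolP.
Qed.

Lemma FGF_CF : right_FGF R -> right_CF R.
Proof.
move=> FGF V [v Hv]; apply: FGF; exists 1%N, (fun=> v) => x.
by have [r ->] := Hv x; exists (fun=> r); rewrite big_ord1.
Qed.

End Annihilators.

(** * Minimal right ideals and their types *)

Section MaximalRightIdeals.
Variable R : pzRingType.
Implicit Types (I K M N : set R) (x y : R).

Definition maximal_right_ideal M :=
  [/\ right_ideal M, ~ M 1 &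
      forall N, right_ideal N -> M `<=` N -> N `<=` M \/ N 1].

Lemma maximal_submoduleP M : maximal_right_ideal M ->
  maximal_submodule ([pred a | `[< M a >]] : {pred right_regular R}).
Proof.
move=> [rM M1 maxM]; split; first exact: right_ideal_submod.
  by exists (1 : R); apply/asboolP.
move=> N sN MN; have rN := submod_right_ideal sN.
have [|NM|N1] := maxM _ rN; first by move=> a Ma; apply/MN/asboolP.
  by left=> a; apply/idP/asboolP => [/NM//|Ma]; apply/MN/asboolP.
right=> a; apply/idP; have [_ _ NMl] := rN.
by have := NMl 1 a N1; rewrite mul1r.
Qed.

Lemma jacobsonP x : x \in jacobson_radical R <->
  forall M, maximal_right_ideal M -> M x.
Proof.
split=> [/asboolP H M /maximal_submoduleP/H/asboolP//|H].
apply/asboolP => M [sM [u Mu] maxM]; apply: (H (fun a => a \in M)).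
split; first exact: submod_right_ideal.
  move=> M1; have [_ _ MM] := submod_right_ideal sM.
  by have := MM 1 u M1; rewrite mul1r (negbTE Mu).
move=> N rN MN; have [|NM|NT] := maxM _ (right_ideal_submod rN).
- by move=> a Ma; apply/asboolP/MN.
- by left=> a Na; rewrite -NM; apply/asboolP.
- by right; apply/asboolP; move: (NT 1); rewrite inE.
Qed.

End MaximalRightIdeals.

(** * T-nilpotence of the radical in factor rings of [R] *)

Section RadicalOfQuotients.
Variable R : pzRingType.
Implicit Types K N : set R.

Lemma maximal_right_ideal_pi K (sK : two_sided K) (M : set (quotient_ring sK)) :
  maximal_right_ideal M -> maximal_right_ideal (fun x => M (\pi x)).
Proof.
move=> [[M0 MD MM] M1 maxM]; have [K0 _ _ _] := sK.
have KM k : K k -> M (\pi k) by move=> /(pi_ring_eq0 sK)->.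
split.
- split=> [|a b Ma Mb|a r Ma]; first by apply: KM.
    by rewrite pi_ring_add; apply: MD.
  by rewrite pi_ringM; apply: MM.
- exact: M1.
move=> N [N0 ND NM] MN.
pose N' (y : quotient_ring sK) := exists2 x, N x & y = \pi_(quotient_ring sK) x.
have rN' : right_ideal N'.
  split; first by exists 0 => //; apply/esym/pi_ring_eq0.
    move=> _ _ [a Na ->] [b Nb ->]; exists (a + b); first exact: ND.
    by rewrite pi_ring_add.
  move=> _ + [a Na ->]; elim/quotW=> r; exists (a * r); first exact: NM.
  by rewrite pi_ringM.
have [|N'M|[x Nx /quotient_ring_eq K1x]] := maxM _ rN'.
- by elim/quotW=> x Mx; exists x => //; apply: MN.
- by left=> x Nx; apply: N'M; exists x.
- right; rewrite -(subrK x 1); apply: ND => //; apply: MN; exact: KM.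
Qed.

Fixpoint left_prod (a : nat -> R) (n : nat) : R :=
  if n is k.+1 then a k * left_prod a k else 1.

Hypothesis hT : completely_right_T_nilpotent_radical (singular_quotient R).
Local Notation Z := (right_singular_ideal R).

Lemma T_nilpotent_modulo K (a : nat -> R) : two_sided K ->
  (forall z, z \in Z -> K z) ->
  (forall n M, maximal_right_ideal M -> K `<=` M -> M (a n)) ->
  exists n, K (left_prod a n).
Proof.
move=> sK ZK aJ; have [f fsurj] := singular_quotient_onto sK ZK.
(* The sequences of [right_T_nilpotent] start at index 1, whence the predecessor. *)
have [|n0 _] := hT fsurj (r := fun i => \pi_(quotient_ring sK) (a i.-1)).
  move=> i _; apply/jacobsonP => M maxM.
  apply: (aJ i.-1 (fun x => M (\pi x))); first exact: maximal_right_ideal_pi.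
  by move=> k /(pi_ring_eq0 sK)->; case: maxM => -[].
have -> : \prod_(i < n0) \pi_(quotient_ring sK) (a (n0 - i).-1) =
    \pi_(quotient_ring sK) (left_prod a n0).
  elim: n0 => [|n IH]; first by rewrite big_ord0.
  rewrite big_ord_recl subn0 /= pi_ringM -IH; congr (_ * _).
by move=> /pi_ring_eq0; exists n0.
Qed.

(* A product [a_n ... a_1] leaving [K1] at no stage contradicts T-nilpotence, so
   [K2 / K1] does not lie in the radical of [R / K1]. *)
Lemma maximal_between (K1 K2 : set R) : two_sided K1 -> two_sided K2 ->
  (forall z, z \in Z -> K1 z) -> (exists2 a, K2 a & ~ K1 a) ->
  (forall a, K2 a -> ~ K1 a -> exists2 b, K2 b & ~ K1 (b * a)) ->
  exists M, [/\ maximal_right_ideal M, K1 `<=` M & exists2 k, K2 k & ~ M k].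
Proof.
move=> sK1 sK2 ZK1 [a0 K2a0 K1a0] step; apply: contrapT => noM.
have K2M M : maximal_right_ideal M -> K1 `<=` M -> K2 `<=` M.
  move=> maxM K1M k K2k; apply: contrapT => Mk; apply: noM.
  by exists M; split=> //; exists k.
have /choice[b Hb] a : exists b, K2 a -> ~ K1 a -> K2 b /\ ~ K1 (b * a).
  have [[K2a K1a]|na] := pselect (K2 a /\ ~ K1 a); last by exists 0 => *; case: na.
  by have [b] := step _ K2a K1a; exists b.
pose q n := iter n (fun p => b p * p) a0.
have Hq n : K2 (q n) /\ ~ K1 (q n).
  elim: n => // n [K2q K1q]; have [K2b K1b] := Hb _ K2q K1q.
  by split=> //; have [_ _ Kl _] := sK2; apply: Kl.
pose a n := if n is m.+1 then b (q m) else a0.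
have Ka n : K2 (a n).
  by case: n => // n; have [K2q K1q] := Hq n; have [] := Hb _ K2q K1q.
have [n maxM K1M|n] := T_nilpotent_modulo sK1 ZK1 (a := a).
  by move=> K1M'; apply: K2M (Ka n).
case: n => [|n] /=.
  by move=> K11; apply: K1a0; have [_ _ Kl _] := sK1; rewrite -[a0]mulr1; apply: Kl.
(* [q n] is the product of the [n.+1] factors from [a n] down to [a 0]. *)
suff -> : a n * left_prod a n = q n by have [] := Hq n.
elim: n => [|n IH] /=; first by rewrite mulr1.
by rewrite IH.
Qed.

End RadicalOfQuotients.

(** * Minimal elements, homogeneous components and their annihilators *)

Section MinimalElements.
Variable R : pzRingType.
Implicit Types (I K M N : set R) (x y : R).
Local Notation Z := (right_singular_ideal R).

(* [x R] is zero or simple. *)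
Definition minimal0 x := forall c, x * c != 0 -> exists d, x * c * d = x.

Definition minimal x := x <> 0 /\ minimal0 x.

Lemma minimal0_mull r x : minimal0 x -> minimal0 (r * x).
Proof.
move=> mx c rxc; have [|d xcd] := mx c; last first.
  by exists d; rewrite -!mulrA [x * _]mulrA xcd.
by apply: contraNneq rxc => xc; rewrite -mulrA xc mulr0.
Qed.

Lemma minimal0_mulr x r : minimal0 x -> minimal0 (x * r).
Proof.
move=> mx c xrc; have [|d xcd] := mx (r * c); first by rewrite mulrA.
by exists (d * r); rewrite mulrA -[x * r * c]mulrA xcd.
Qed.

(** The annihilator of [z] is essential, so it meets a simple [x R] and therefore contains it. *)
Lemma singular_minimal0 z x : z \in Z -> minimal0 x -> z * x = 0.
Proof.
move=> /right_singularP Hz mx; have [->|x0] := eqVneq x 0; first exact: mulr0.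
pose N : {pred right_regular R} := [pred a | `[< exists r, a = x * r >]].
have sN : submod_closed N.
  split; first by apply/asboolP; exists 0; rewrite mulr0.
  move=> c _ _ /asboolP[a ->] /asboolP[b ->]; apply/asboolP.
  by exists (a * c + b); rewrite mulrDr mulrA.
have [|a [za /asboolP[r ar] a0]] := Hz N sN.
  by exists x => //; apply/asboolP; exists 1; rewrite mulr1.
have [|d xrd] := mx r; first by rewrite -ar.
by rewrite -xrd -ar mulrA za mul0r.
Qed.

(** [M] is the annihilator of a finite set. By maximality it is the annihilator of any nonzero [x]
    of that set, and [x R] is isomorphic to [R / M]. *)
Lemma maximal_annihilator (CF : right_CF R) M : maximal_right_ideal M ->
  exists x, minimal x /\ forall a, M a <-> x * a = 0.
Proof.
move=> [rM M1 maxM]; have [s Hs] := CF_annihilator CF rM.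
have [x xs x0] : exists2 x, x \in s & x <> 0.
  apply: contrapT => nx; apply: M1; apply/Hs => x xs.
  by rewrite mulr1; apply: contrapT => x0; apply: nx; exists x.
have xM a : M a <-> x * a = 0.
  split=> [/Hs/(_ _ xs)//|]; have [||N1|] := maxM (fun a => x * a = 0).
  - split=> [|b c xb xc|b r xb]; rewrite ?mulr0 //.
      by rewrite mulrDr xb xc addr0.
    by rewrite mulrA xb mul0r.
  - by move=> b /Hs/(_ _ xs).
  - exact: N1.
  - by rewrite mulr1.
exists x; split=> //; split=> // c /eqP/xM Mc.
have [M0 MD MM] := rM.
pose N b := exists m r, M m /\ b = m + c * r.
have [||NM|[m [r [Mm e]]]] := maxM N.
- split; first by exists 0, 0; rewrite mulr0 addr0.
    move=> _ _ [m [r [Mm ->]]] [m' [r' [Mm' ->]]]; exists (m + m'), (r + r').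
    by split; [exact: MD | rewrite mulrDr addrACA].
  move=> _ t [m [r [Mm ->]]]; exists (m * t), (r * t).
  by split; [exact: MM | rewrite mulrDl mulrA].
- by move=> m Mm; exists m, 0; rewrite mulr0 addr0.
- by case: Mc; apply: NM; exists 0, 1; rewrite mulr1 add0r.
exists r; rewrite -mulrA -[RHS]mulr1 e mulrDr.
by have /xM-> := Mm; rewrite add0r.
Qed.

(* [x R] and [y R] are isomorphic, for [x] and [y] minimal. *)
Definition sim x y := exists u, forall a, x * a = 0 <-> y * u * a = 0.

Lemma sim_refl x : sim x x.
Proof. by exists 1 => a; rewrite mulr1. Qed.

Lemma sim_sym x y : minimal x -> minimal y -> sim x y -> sim y x.
Proof.
move=> [x0 _] [_ my] [u xyu]; have [|v yuv] := my u.
  by apply/eqP => yu0; apply: x0; rewrite -[x]mulr1; apply/xyu; rewrite yu0 mul0r.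
by exists v => a; rewrite -[x * v * a]mulrA xyu mulrA yuv.
Qed.

Lemma sim_trans x y z : sim x y -> sim y z -> sim x z.
Proof.
move=> [u xy] [v yz]; exists (v * u) => a.
by rewrite xy -mulrA yz !mulrA.
Qed.

Lemma sim_mull s y : minimal y -> s * y <> 0 -> sim (s * y) y.
Proof.
move=> [_ my] sy; exists 1 => a; rewrite mulr1; split=> [sya|ya].
  apply: contrapT => /eqP ya; have [d yad] := my a ya.
  by apply: sy; rewrite -yad !mulrA sya mul0r.
by rewrite -mulrA ya mulr0.
Qed.

Lemma sim_mulr y r : sim (y * r) y.
Proof. by exists r. Qed.

Lemma minimal_mull s y : minimal y -> s * y <> 0 -> minimal (s * y).
Proof. by case=> _ my; split=> //; apply: minimal0_mull. Qed.

Lemma minimal_mulr y r : minimal y -> y * r <> 0 -> minimal (y * r).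
Proof. by case=> _ my; split=> //; apply: minimal0_mulr. Qed.

(** The choice depends only on the isomorphism class as a set, so isomorphic minimal right ideals
    get the same representative. *)
Definition rep x := xget 0 [set y | minimal y /\ sim y x].

Lemma rep_minimal x : minimal x -> minimal (rep x).
Proof.
move=> mx; rewrite /rep; case: xgetP => [y _ []//|/(_ x)[]].
by split=> //; exact: sim_refl.
Qed.

Lemma sim_rep x : minimal x -> sim (rep x) x.
Proof.
move=> mx; rewrite /rep; case: xgetP => [y _ []//|/(_ x)[]].
by split=> //; exact: sim_refl.
Qed.

Lemma rep_eq x y : minimal x -> minimal y -> rep x = rep y <-> sim x y.
Proof.
move=> mx my; split=> [e|xy].
  apply: (sim_trans _ (sim_rep my)); rewrite -e.
  by apply: sim_sym => //; [exact: rep_minimal | exact: sim_rep].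
congr (xget _ _); apply/seteqP; split=> z [mz zs]; split=> //.
  exact: sim_trans zs xy.
exact: sim_trans zs (sim_sym mx my xy).
Qed.

Lemma rep_mull s y : minimal y -> s * y <> 0 -> rep (s * y) = rep y.
Proof.
by move=> my sy; apply/rep_eq => //; [exact: minimal_mull|exact: sim_mull].
Qed.

Lemma rep_mulr y r : minimal y -> y * r <> 0 -> rep (y * r) = rep y.
Proof.
by move=> my sy; apply/rep_eq => //; [exact: minimal_mulr|exact: sim_mulr].
Qed.

Lemma annihilator_rep K x y : two_sided K -> minimal x -> minimal y ->
  rep x = rep y -> (forall k, K k -> x * k = 0) -> forall k, K k -> y * k = 0.
Proof.
move=> [_ _ Kl _] mx my /(rep_eq mx my)/(sim_sym mx my)[u yxu] xK k Kk.
by apply/yxu; rewrite -mulrA; apply/xK/Kl.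
Qed.

Definition typed (B : set R) x := x = 0 \/ minimal x /\ B (rep x).

Lemma typed_minimal0 B x : typed B x -> minimal0 x.
Proof. by case=> [-> c|[[]]//]; rewrite mul0r eqxx. Qed.

Lemma typed_mull B r x : typed B x -> typed B (r * x).
Proof.
case=> [->|[mx Bx]]; first by left; rewrite mulr0.
have [->|/eqP rx] := eqVneq (r * x) 0; [by left | right].
by rewrite rep_mull //; split=> //; apply: minimal_mull.
Qed.

Lemma typed_mulr B r x : typed B x -> typed B (x * r).
Proof.
case=> [->|[mx Bx]]; first by left; rewrite mul0r.
have [->|/eqP rx] := eqVneq (x * r) 0; [by left | right].
by rewrite rep_mulr //; split=> //; apply: minimal_mulr.
Qed.

(** The sum of the homogeneous components of the right socle with types in [B]. *)
Definition socle (B : set R) a :=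
  exists2 s : seq R, (forall x, x \in s -> typed B x) & a = \sum_(x <- s) x.

Lemma socle_typed B x : typed B x -> socle B x.
Proof.
by exists [:: x]; [move=> y; rewrite inE => /eqP->|rewrite big_seq1].
Qed.

Lemma socle_right_ideal B : right_ideal (socle B).
Proof.
split; first by exists [::] => //; rewrite big_nil.
  move=> _ _ [s sB ->] [t tB ->]; exists (s ++ t); last by rewrite big_cat.
  by move=> x; rewrite mem_cat => /orP[/sB|/tB].
move=> _ r [s sB ->]; exists [seq x * r | x <- s].
  by move=> _ /mapP[x /sB Bx ->]; apply: typed_mulr.
by rewrite big_map mulr_suml.
Qed.

Lemma socle_mull B r a : socle B a -> socle B (r * a).
Proof.
move=> [s sB ->]; exists [seq r * x | x <- s].
  by move=> _ /mapP[x /sB Bx ->]; apply: typed_mull.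
by rewrite big_map mulr_sumr.
Qed.

(** The hypothesis makes [y R] a subquotient of a sum of simple modules of types in [B]. If some [a]
    kills the tail of [s] but not [y], then [x a R] maps onto [y a R]; both are simple, so [x] and
    [y] have the same type. *)
Lemma minimal_socle_type B (s : seq R) y : (forall x, x \in s -> typed B x) ->
  minimal y -> (forall a, (forall x, x \in s -> x * a = 0) -> y * a = 0) ->
  B (rep y).
Proof.
move=> + my; elim: s => [|x s IH] sB ya.
  by case: my => y0 _; case: y0; rewrite -[y]mulr1; apply: ya.
have [H|/existsNP[a /not_implyP[sa ya0]]] :=
    pselect (forall a, (forall x, x \in s -> x * a = 0) -> y * a = 0).
  by apply: IH => // z zs; apply: sB; rewrite in_cons zs orbT.
have xa b : x * a * b = 0 -> y * a * b = 0.
  move=> xab; rewrite -mulrA; apply: ya => z; rewrite in_cons => /predU1P[->|zs].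
    by rewrite mulrA.
  by rewrite mulrA sa // mul0r.
have x0 : x * a <> 0.
  by move=> xa0; apply: ya0; rewrite -[_ * a]mulr1; apply: xa; rewrite xa0 mul0r.
have [x0'|[mx Bx]] := sB x (mem_head _ _); first by case: x0; rewrite x0' mul0r.
suff -> : rep y = rep x by [].
rewrite -(rep_mulr my ya0) -(rep_mulr mx x0).
apply/rep_eq; [exact: minimal_mulr|exact: minimal_mulr|].
exists 1 => b; rewrite mulr1; split=> [yab|/xa//].
apply: contrapT => /eqP xab; have [_ mxa] := minimal_mulr mx x0.
have [d xabd] := mxa b xab; apply: ya0.
have : x * a * (1 - b * d) = 0 by rewrite mulrBr mulr1 mulrA xabd subrr.
by move=> /xa; rewrite mulrBr mulr1 mulrA yab mul0r subr0.
Qed.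

Lemma socle_minimal B y : minimal y -> socle B y -> B (rep y).
Proof.
move=> my [s sB ey]; apply: (minimal_socle_type sB my) => a sa.
by rewrite ey mulr_suml big_seq big1.
Qed.

(** The ideal written K_B in the outline of the proof. *)
Definition killer (B : set R) s := forall x, minimal x -> ~ B (rep x) -> s * x = 0.

Lemma killer_two_sided B : two_sided (killer B).
Proof.
split=> [x _ _|s t Ks Kt x mx Bx|r s Ks x mx Bx|s r Ks x mx Bx].
- exact: mul0r.
- by rewrite mulrBl Ks // Kt // subrr.
- by rewrite -mulrA Ks // mulr0.
- rewrite -mulrA; have [->|/eqP rx] := eqVneq (r * x) 0; first exact: mulr0.
  by apply: Ks; [exact: minimal_mull | rewrite rep_mull].
Qed.

Lemma killer_singular B z : z \in Z -> killer B z.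
Proof. by move=> Zz x [_ mx] _; apply: singular_minimal0. Qed.

Lemma killerS (B B' : set R) : B `<=` B' -> killer B `<=` killer B'.
Proof. by move=> BB' s Ks x mx Bx; apply: Ks => // /BB'. Qed.

Lemma killer_mul (B B' : set R) s t : killer B s -> killer B' t ->
  killer (B `&` B') (s * t).
Proof.
move=> Ks Kt x mx /not_andP[Bx|Bx]; last by rewrite -mulrA Kt // mulr0.
rewrite -mulrA; have [->|/eqP tx] := eqVneq (t * x) 0; first exact: mulr0.
by apply: Ks; [exact: minimal_mull | rewrite rep_mull].
Qed.

(** The components of types outside [B] form the annihilator of a finite list. A minimal [y] killed
    by the whole list lies in them, so its type is outside [B]. *)
Lemma killer_separates (CF : right_CF R) B : exists2 s : seq R,
  (forall x, x \in s -> killer B x) &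
  forall y, minimal y -> B (rep y) -> exists2 x, x \in s & x * y <> 0.
Proof.
have [s Hs] := CF_annihilator CF (socle_right_ideal (~` B)).
exists s => [x xs y my By|y my By].
  by apply: (Hs y).1 => //; apply: socle_typed; right.
apply: contrapT => nx; have /(socle_minimal my) : socle (~` B) y.
  by apply/Hs => x xs; apply: contrapT => xy; apply: nx; exists x.
by apply.
Qed.

End MinimalElements.

(** * Finiteness of the number of types *)

Section Counting.
Variable R : pzRingType.
Local Notation Z := (right_singular_ideal R).

(* The isomorphism classes of simple right [R]-modules, when every simple right
   module embeds in [R]. *)
Definition simple_type := {x : R | minimal x /\ rep x = x}.

Lemma rep_simple_type (x : R) : minimal x -> exists t : simple_type, sval t = rep x.
Proof.
move=> mx; have mr := rep_minimal mx.
have rr : rep (rep x) = rep x by apply/rep_eq => //; exact: sim_rep.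
by exists (exist _ (rep x) (conj mr rr)).
Qed.

Hypothesis CF : right_CF R.
Hypothesis hT : completely_right_T_nilpotent_radical (singular_quotient R).

(** The counting principle. By [maximal_between] each layer [K2 j / K1 j] gives a simple module
    killed by [K1 j] but not by [K2 j]. If layers [i] and [j] gave the same simple module, it would
    be killed neither by [K2 i] nor by [K2 j], hence not by their product, although one of [K1 i],
    [K1 j] contains that product. *)
Lemma simple_type_injection (J : Type) (K1 K2 : J -> set R) :
  (forall j, two_sided (K1 j)) -> (forall j, two_sided (K2 j)) ->
  (forall j z, z \in Z -> K1 j z) ->
  (forall j, exists2 a, K2 j a & ~ K1 j a) ->
  (forall j a, K2 j a -> ~ K1 j a -> exists2 b, K2 j b & ~ K1 j (b * a)) ->
  (forall i j, i <> j ->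
    (forall a b, K2 i a -> K2 j b -> K1 i (a * b)) \/
    (forall a b, K2 i a -> K2 j b -> K1 j (a * b))) ->
  exists g : J -> simple_type, injective g /\ forall j,
    (forall k, K1 j k -> sval (g j) * k = 0) /\
    exists2 k, K2 j k & sval (g j) * k <> 0.
Proof.
move=> sK1 sK2 ZK1 K2n K2s cross.
have /choice[g gP] j : exists t : simple_type,
    (forall k, K1 j k -> sval t * k = 0) /\ exists2 k, K2 j k & sval t * k <> 0.
  have [M [maxM K1M [k K2k Mk]]] :=
    maximal_between hT (sK1 j) (sK2 j) (ZK1 j) (K2n j) (K2s j).
  have [x [mx xM]] := maximal_annihilator CF maxM.
  have [t et] := rep_simple_type mx.
  have [mt rt] := svalP t.
  have ext : rep x = rep (sval t) by rewrite rt.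
  exists t; split.
    apply: (annihilator_rep (sK1 j) mx mt ext) => k' K1k'.
    exact/xM/K1M.
  apply: contrapT => nt; apply/Mk/xM.
  apply: (annihilator_rep (sK2 j) mt mx (esym ext)) => // k' K2k'.
  by apply: contrapT => tk'; apply: nt; exists k'.
exists g; split=> // i j gij; apply: contrapT => /cross ij.
have [x0 [a K2a xa]] := gP i; have [y0 [b K2b yb]] := gP j.
have [_ mx] : minimal (sval (g i)) by case: (svalP (g i)).
have /eqP/mx[d xad] := xa.
have K2db : K2 j (d * b) by case: (sK2 j) => _ _ Kl _; apply: Kl.
apply: yb; rewrite -gij -xad -!mulrA.
by case: ij => /(_ _ _ K2a K2db); [exact: x0 | rewrite gij; exact: y0].
Qed.

Definition of_type (A : set simple_type) : set R := fun r => exists2 t, A t & sval t = r.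

Lemma of_type_sval A (t : simple_type) : of_type A (sval t) -> A t.
Proof.
move=> [u Au e]; suff <- : u = t by [].
case: u t {Au} e => [u pu] [t pt] /= e; subst t.
by congr exist; apply: Prop_irrelevance.
Qed.

(** An independent family indexed by all sets of types yields one layer per set, hence an injection
    of the power set into the set of types, against Cantor's theorem. *)
Lemma no_sequence_of_types (i : nat -> simple_type) : ~ injective i.
Proof.
move=> iI; have [A indep] := independent_family iI.
pose K2 Y : set R := killer (of_type (A Y)).
(* [U Y l] is the part of [A Y] covered by the members with index in [l]. [K1 Y] is the directed
   union of the corresponding ideals; by [killer_mul] it absorbs the products of [K2 Y] with every
   other [K2 Y']. *)
pose U (Y : set simple_type) (l : seq (set simple_type)) : set R :=
  fun r => of_type (A Y) r /\ exists2 Y', Y' \in l & of_type (A Y') r.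
pose K1 Y : set R := fun s => exists2 l, Y \notin l & killer (U Y l) s.
have US Y l l' : {subset l <= l'} -> U Y l `<=` U Y l'.
  by move=> ll' r [Ar [Y' /ll' ? ?]]; split=> //; exists Y'.
have sK1 Y : two_sided (K1 Y).
  split.
  - by exists [::] => //; have [] := killer_two_sided (U Y [::]).
  - move=> s t [l lY Ks] [l' lY' Kt]; exists (l ++ l').
      by rewrite mem_cat negb_or lY.
    have [_ KB _ _] := killer_two_sided (U Y (l ++ l')).
    by apply: KB; [apply: killerS Ks|apply: killerS Kt]; apply: US => Y' h;
      rewrite mem_cat h ?orbT.
  - move=> r s [l lY Ks]; exists l => //.
    by have [_ _ Kl _] := killer_two_sided (U Y l); apply: Kl.
  - move=> s r [l lY Ks]; exists l => //.
    by have [_ _ _ Kr] := killer_two_sided (U Y l); apply: Kr.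
(* If [K2 Y] sends [a] into [K1 Y], one list [l] serves all the finitely many separating elements;
   so [a] kills what has its type in [A Y] but not in [U Y l]. *)
have sep Y a : (forall b, K2 Y b -> K1 Y (b * a)) ->
    exists2 l, Y \notin l & forall y, minimal y -> of_type (A Y) (rep y) ->
      ~ U Y l (rep y) -> a * y = 0.
  move=> Ka; have [xs xsK xsep] := killer_separates CF (of_type (A Y)).
  have [l lY lK] : exists2 l, Y \notin l & forall x, x \in xs -> killer (U Y l) (x * a).
    elim: xs xsK {xsep} => [|x xs IH] xsK; first by exists [::].
    have [|l lY lK] := IH; first by move=> y yx; apply: xsK; rewrite in_cons yx orbT.
    have [l' lY' Kx] := Ka x (xsK x (mem_head _ _)).
    exists (l ++ l'); first by rewrite mem_cat negb_or lY.
    move=> y; rewrite in_cons => /predU1P[->|/lK Ky].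
      by apply: killerS Kx; apply: US => Y' h; rewrite mem_cat h orbT.
    by apply: killerS Ky; apply: US => Y' h; rewrite mem_cat h.
  exists l => // y my Ay Uy; apply: contrapT => ay.
  have [|x xxs] := xsep _ (minimal_mull my ay); first by rewrite rep_mull.
  by apply; rewrite mulrA lK.
have [||||||g [gI _]] := @simple_type_injection (set simple_type) K1 K2.
- exact: sK1.
- by move=> Y; apply: killer_two_sided.
- by move=> Y z Zz; exists [::] => //; apply: killer_singular.
- move=> Y; apply: contrapT => nK.
  have [b K2b|l lY Hl] := sep Y 1.
    by rewrite mulr1; apply: contrapT => K1b; apply: nK; exists b.
  have [x Ax Al] := indep Y l lY; have [mx rx] := svalP x.
  have x0 : 1 * sval x = 0.
    apply: Hl => //; rewrite rx; first by exists x.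
    by move=> [_ [Y' Y'l /of_type_sval]]; apply: Al.
  by case: mx => + _; rewrite -[sval x]mul1r.
- move=> Y a K2a K1a; apply: contrapT => nK; apply: K1a.
  have [b K2b|l lY Hl] := sep Y a.
    by apply: contrapT => K1b; apply: nK; exists b.
  exists l => // y my Uy.
  by have [Ay|Ay] := pselect (of_type (A Y) (rep y)); [exact: Hl|exact: K2a].
- move=> Y Y' YY'; left=> a b Ka Kb; exists [:: Y'].
    by rewrite inE; apply/eqP.
  apply: killerS (killer_mul Ka Kb) => r [Ar Ar']; split=> //.
  by exists Y'; rewrite ?mem_head.
exact: no_powerset_embedding gI.
Qed.

(** Such an injection would make the set of types Dedekind-infinite: the orbit of [g None] is an
    injective sequence. *)
Lemma no_option_injection (g : option simple_type -> simple_type) : ~ injective g.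
Proof.
move=> gI; pose i n := iter n (fun t => g (Some t)) (g None).
apply: (@no_sequence_of_types i); elim=> [|m IH] [|n] //=.
- by move=> /gI.
- by move=> /gI.
- by move=> /gI[] /IH->.
Qed.

Lemma finite_simple_types : exists ts : seq R,
  (forall t, t \in ts -> minimal t /\ rep t = t) /\
  forall x, minimal x -> rep x \in ts.
Proof.
have : finite_set [set x : R | minimal x /\ rep x = x].
  apply/finite_setPn => /card_leP[f].
  pose g n : R := val (f (SigSub (mem_set (I : [set: nat] n)))).
  have gP n : minimal (g n) /\ rep (g n) = g n.
    by have /set_mem := valP (f (SigSub (mem_set (I : [set: nat] n)))).
  apply: (@no_sequence_of_types (fun n => exist _ (g n) (gP n))) => m n e.
  have /val_inj/(@functions.inj _ _ _ f)/= : g m = g n by exact: (congr1 sval e).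
  by rewrite !inE => /(_ I I)/(congr1 val).
move=> /finite_seqP[ts tsE]; exists ts; split=> [t tts|x mx].
  by have : [set` ts] t by []; rewrite -tsE.
suff : [set` ts] (rep x) by [].
rewrite -tsE; split; first exact: rep_minimal.
by have [t <-] := rep_simple_type mx; case: (svalP t).
Qed.

End Counting.

(** * The right socle *)

Section Span.
Variable R : pzRingType.
Implicit Types (P I : set R) (s t xs : seq R).

Fixpoint rspan t : set R :=
  if t is x :: t' then fun a => exists r, rspan t' (a - x * r) else fun a => a = 0.

Lemma rspan_right_ideal t : right_ideal (rspan t).
Proof.
elim: t => [|x t [t0 tD tM]] /=.
  by split=> // [a b -> ->|a r ->]; rewrite ?addr0 ?mul0r.
split; first by exists 0; rewrite mulr0 subr0.
  move=> a b [r ar] [q bq]; exists (r + q); rewrite mulrDr opprD addrACA.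
  exact: tD.
by move=> a q [r ar]; exists (r * q); rewrite mulrA -mulrBl; apply: tM.
Qed.

Lemma mem_span t x : x \in t -> rspan t x.
Proof.
have [sp0 _ _] := rspan_right_ideal t.
elim: t sp0 => //= y t IH _; have [t0 _ _] := rspan_right_ideal t.
rewrite in_cons => /predU1P[->|/(IH t0) tx]; first by exists 1; rewrite mulr1 subrr.
by exists 0; rewrite mulr0 subr0.
Qed.

Lemma rspan_min t I : right_ideal I -> (forall x, x \in t -> I x) -> rspan t `<=` I.
Proof.
move=> [I0 ID IM]; elim: t => [|x t IH] tI a /=; first by move=> ->.
move=> [r tar]; rewrite -[a](subrK (x * r)); apply: ID.
  by apply: IH tar => y yt; apply: tI; rewrite in_cons yt orbT.
by apply/IM/tI; rewrite mem_head.
Qed.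

Lemma rspanS s t : {subset s <= t} -> rspan s `<=` rspan t.
Proof.
by move=> st; apply: rspan_min => [|x /st/mem_span//]; apply: rspan_right_ideal.
Qed.

Lemma rspan_map x t a : rspan [seq x * y | y <- t] a ->
  exists2 b, rspan t b & a = x * b.
Proof.
elim: t a => [|y t IH] a /=; first by move=> ->; exists 0; rewrite ?mulr0.
move=> [r /IH[b tb e]]; exists (b + y * r); first by exists r; rewrite addrK.
by rewrite mulrDr -e mulrA subrK.
Qed.

Lemma rspan_mull x t a : rspan t a -> rspan [seq x * y | y <- t] (x * a).
Proof.
elim: t a => [|y t IH] a /=; first by move=> ->; rewrite mulr0.
by move=> [r /IH H]; exists r; rewrite -mulrA -mulrBr.
Qed.

Definition finitely_generated P :=
  exists2 t, (forall x, x \in t -> P x) & P `<=` rspan t.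

Definition minimal0_seq t := forall x, x \in t -> minimal0 x.

Lemma minimal0_seq_cat s t : minimal0_seq s -> minimal0_seq t ->
  minimal0_seq (s ++ t).
Proof. by move=> ms mt x; rewrite mem_cat => /orP[/ms|/mt]. Qed.

(** Induction on [t]: modulo its intersection with the span of the tail, [P] embeds in a quotient of
    [x R], which is zero or simple, so one more generator [p] suffices. *)
Lemma sub_span_finitely_generated P t : right_ideal P -> minimal0_seq t ->
  P `<=` rspan t -> finitely_generated P.
Proof.
elim: t P => [|x t IH] P rP mt /= Pt.
  by exists [::] => // a /Pt.
have mt' : minimal0_seq t by move=> y yt; apply: mt; rewrite in_cons yt orbT.
have rt := rspan_right_ideal t.
have [|t' t'P Pt'] := IH (P `&` rspan t) _ mt' (@subIsetr _ _ _).
  case: rP rt => [P0 PD PM] [t0 tD tM]; split=> // [a b [Pa ta] [Pb tb]|a r [Pa ta]].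
    by split; [exact: PD|exact: tD].
  by split; [exact: PM|exact: tM].
have [PP|/existsNP[p /not_implyP[Pp np]]] := pselect (P `<=` rspan t).
  by exists t' => [y /t'P[]//|a Pa]; apply: Pt'; split=> //; exact: PP.
have [r pr] := Pt p Pp; have xr0 : x * r != 0.
  by apply/eqP => xr0; apply: np; rewrite -[p]subr0 -xr0.
have [d xrd] := mt x (mem_head _ _) r xr0.
exists (p :: t') => [y|a Pa]; first by rewrite in_cons => /predU1P[->|/t'P[]].
have [r' ar'] := Pt a Pa; exists (d * r'); apply: Pt'; split.
  by apply: (right_idealB rP) => //; case: rP => _ _ PM; apply: PM.
have -> : a - p * (d * r') = (a - x * r') - (p - x * r) * (d * r').
  by rewrite mulrBl mulrA (mulrA (x * r)) xrd opprB addrA subrK -mulrA.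
by apply: (right_idealB rt) => //; case: rt => _ _; apply.
Qed.

Lemma lift_seq P x s : (forall y, y \in s -> exists2 a, P a & y = x * a) ->
  exists2 t, (forall a, a \in t -> P a) & s = [seq x * a | a <- t].
Proof.
elim: s => [|y s IH] H; first by exists [::].
have [a Pa ya] := H y (mem_head _ _).
have [|t tP e] := IH; first by move=> z zs; apply: H; rewrite in_cons zs orbT.
exists (a :: t); last by rewrite /= -ya -e.
by move=> z; rewrite in_cons => /predU1P[->|/tP].
Qed.

(** Induction on [xs] along the exact sequence given by left multiplication by [x] on [P]: the image
    [x P] is finitely generated inside a semisimple module, and the kernel falls under the induction
    hypothesis. *)
Lemma finitely_generated_lift P xs : right_ideal P ->
  (forall x, x \in xs -> exists2 t, minimal0_seq t &
    forall a, P a -> rspan t (x * a)) ->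
  finitely_generated (P `&` [set a | forall x, x \in xs -> x * a = 0]) ->
  finitely_generated P.
Proof.
elim: xs P => [|x xs IH] P rP xsP fP.
  suff -> : P = P `&` [set a | forall x, x \in [::] -> x * a = 0] by [].
  by apply/seteqP; split=> a // [].
have [P0 PD PM] := rP.
pose P' := P `&` [set a | x * a = 0].
have rP' : right_ideal P'.
  split=> [|a b [Pa xa] [Pb xb]|a r [Pa xa]].
  - by split=> //=; rewrite mulr0.
  - by split; [exact: PD|rewrite /= mulrDr xa xb addr0].
  - by split; [exact: PM|rewrite /= mulrA xa mul0r].
have [||u uP' P'u] := IH P' rP'.
- move=> y yxs; have [|t mt Pt] := xsP y; first by rewrite in_cons yxs orbT.
  by exists t => // a [/Pt].
- suff -> : P' `&` [set a | forall y, y \in xs -> y * a = 0] =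
      P `&` [set a | forall y, y \in x :: xs -> y * a = 0] by [].
  apply/seteqP; split=> a /=.
    by move=> [[Pa xa] H]; split=> // y; rewrite in_cons => /predU1P[->|/H].
  move=> [Pa H]; split; first by split=> //; apply: H; rewrite mem_head.
  by move=> y yxs; apply: H; rewrite in_cons yxs orbT.
have [t mt Pt] := xsP x (mem_head _ _).
have [||v vP Pv] := @sub_span_finitely_generated [set x * a | a in P] t _ mt.
- split; first by exists 0; rewrite ?mulr0.
    by move=> _ _ [a Pa <-] [b Pb <-]; exists (a + b); [exact: PD|rewrite mulrDr].
  by move=> _ r [a Pa <-]; exists (a * r); [exact: PM|rewrite mulrA].
- by move=> _ [a /Pt + <-].
have [w wP ev] := @lift_seq P x v (fun y vy => match vP y vy with
  ex_intro2 a Pa e => ex_intro2 _ _ a Pa (esym e) end).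
exists (w ++ u) => [y|a Pa]; first by rewrite mem_cat => /orP[/wP|/uP'[]].
have : rspan v (x * a) by apply: Pv; exists a.
rewrite ev => /rspan_map[b wb xab].
have rwu := rspan_right_ideal (w ++ u); have [_ Dwu _] := rwu.
rewrite -(subrK b a); apply: Dwu; last first.
  by apply: rspanS wb => y; rewrite mem_cat => ->.
apply: (@rspanS u) => [y|]; first by rewrite mem_cat orbC => ->.
apply: P'u; split; last by rewrite /= mulrBr xab subrr.
by apply: (right_idealB rP) => //; apply: (rspan_min rP wP).
Qed.

Lemma socle_span (B : set R) t : (forall x, x \in t -> socle B x) ->
  exists2 t', (forall x, x \in t' -> typed B x) & rspan t `<=` rspan t'.
Proof.
elim: t => [|x t IH] tB; first by exists [::].
have [|t' t'B tt'] := IH; first by move=> y yt; apply: tB; rewrite in_cons yt orbT.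
have [s sB xs] := tB x (mem_head _ _).
exists (s ++ t') => [y|]; first by rewrite mem_cat => /orP[/sB|/t'B].
have [r0 rD rM] := rspan_right_ideal (s ++ t').
apply: rspan_min => [|y]; first exact: rspan_right_ideal.
rewrite in_cons => /predU1P[->|/mem_span/tt']; last first.
  by apply: rspanS => z; rewrite mem_cat orbC => ->.
rewrite xs big_seq; apply: (@big_ind _ (rspan (s ++ t'))) => // z zs.
by apply: mem_span; rewrite mem_cat zs.
Qed.

Lemma typed_minimal0_seq (B : set R) t :
  (forall x, x \in t -> typed B x) -> minimal0_seq t.
Proof. by move=> tB x /tB/typed_minimal0. Qed.

(** If some [c] kills the component [x r] of [q] but not [q], induction applies to [q c]. Otherwise
    [q R] is a nonzero image of [x r R], hence simple. *)
Lemma rspan_minimal_multiple t (q : R) : minimal0_seq t -> rspan t q -> q <> 0 ->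
  exists c : R, minimal (q * c).
Proof.
elim: t q => [|x t IH] q mt /=; first by [].
move=> [r tqr] q0.
have mt' : minimal0_seq t by move=> y yt; apply: mt; rewrite in_cons yt orbT.
have [[c [xrc qc]]|nc] := pselect (exists c, x * r * c = 0 /\ q * c <> 0).
  have [|d md] := IH (q * c) mt' _ qc; last by exists (c * d); rewrite mulrA.
  have [_ _ tM] := rspan_right_ideal t.
  by have := tM _ c tqr; rewrite mulrBl xrc subr0.
have {}nc c : x * r * c = 0 -> q * c = 0.
  by move=> xrc; apply: contrapT => qc; apply: nc; exists c.
exists 1; rewrite mulr1; split=> // c qc.
have mxr : minimal0 (x * r) by apply/minimal0_mulr/mt; rewrite mem_head.
have [|d xrcd] := mxr c; first by apply: contraNneq qc => /nc->.
exists d; apply/eqP; rewrite -subr_eq0 -mulrA -{2}[q]mulr1 -mulrBr; apply/eqP/nc.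
by rewrite mulrBr mulr1 mulrA xrcd subrr.
Qed.

Lemma socle_minimal_multiple (B : set R) q : socle B q -> q <> 0 ->
  exists c : R, minimal (q * c).
Proof.
move=> sq q0; have [|t tB /(_ q) H] := @socle_span B [:: q].
  by move=> x; rewrite inE => /eqP->.
apply: (rspan_minimal_multiple (typed_minimal0_seq tB)) => //.
by apply: H; apply: mem_span; rewrite mem_head.
Qed.

Lemma maximal_avoiding I y0 : right_ideal I -> ~ I y0 ->
  exists W, [/\ right_ideal W, I `<=` W, ~ W y0 &
    forall N, right_ideal N -> W `<=` N -> ~ N y0 -> N `<=` W].
Proof.
move=> rI Iy0; pose good W := [/\ right_ideal W, I `<=` W & ~ W y0].
have [F FP totF|W [[W0|[rW IW Wy0]] maxW]] :=
    @Zorn_bigcup _ (fun W => W = set0 \/ good W).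
- have [[V [FV gV]]|nV] := pselect (exists V, F V /\ good V); last first.
    left; apply/seteqP; split=> // x [V FV Vx]; have [V0|gV] := FP _ FV.
      by rewrite V0 in Vx.
    by apply: nV; exists V.
  right; have [[V0 VD VM] IV Vy0] := gV.
  have Fgood U x : F U -> U x -> good U.
    by move=> /FP[->//|].
  split; last by move=> [U FU Uy0]; have [_ _] := Fgood _ _ FU Uy0; apply.
    split; first by exists V.
      move=> a b [U FU Ua] [U' FU' U'b].
      have [UU|UU] := totF _ _ FU FU'.
        exists U' => //; have [[_ D _] _ _] := Fgood _ _ FU' U'b.
        by apply: D => //; apply: UU.
      exists U => //; have [[_ D _] _ _] := Fgood _ _ FU Ua.
      by apply: D => //; apply: UU.
    move=> a r [U FU Ua]; exists U => //; have [[_ _ M] _ _] := Fgood _ _ FU Ua.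
    exact: M.
  by move=> a /IV Va; exists V.
- exfalso; apply: (maxW I); last by right; split.
  by rewrite W0; split=> // /(_ 0); apply; case: rI.
exists W; split=> // N rN WN Ny0; apply: contrapT => NW.
by apply: (maxW N) => //; right; split=> //; apply: subset_trans WN.
Qed.

End Span.

(** * The right socle is finitely generated and essential *)

Section FiniteSocle.
Variable R : pzRingType.
Hypothesis CF : right_CF R.
Hypothesis hT : completely_right_T_nilpotent_radical (singular_quotient R).
Local Notation Z := (right_singular_ideal R).

Lemma killer_step (B : set R) a y : minimal y -> B (rep y) -> a * y <> 0 ->
  exists2 b, killer B b & ~ killer set0 (b * a).
Proof.
move=> my By ay; have [xs xsK sep] := killer_separates CF B.
have [|x xxs xay] := sep _ (minimal_mull my ay); first by rewrite rep_mull.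
by exists x; [exact: xsK|move/(_ y my)]; rewrite -mulrA => /(_ (fun f => f)).
Qed.

Lemma not_killer0 a : ~ killer set0 a -> exists2 y : R, minimal y & a * y <> 0.
Proof.
move=> Ka; apply: contrapT => ny; apply: Ka => y my _.
by apply: contrapT => ay; apply: ny; exists y.
Qed.

Lemma killerI0 (t t' : R) a b : t <> t' -> killer [set t] a ->
  killer [set t'] b -> killer set0 (a * b).
Proof.
move=> tt' Ka Kb; apply: killerS (killer_mul Ka Kb) => r [-> e].
by case: tt'.
Qed.

Lemma simple_type_sval_neq (t t' : simple_type R) : t <> t' -> sval t <> sval t'.
Proof.
move=> tt' e; apply: tt'; case: t t' e => [t pt] [t' pt'] /= e; subst t'.
by congr exist; apply: Prop_irrelevance.
Qed.

Lemma killer_type_step (t : simple_type R) a : killer [set sval t] a ->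
  ~ killer set0 a ->
  exists2 b, killer [set sval t] b & ~ killer set0 (b * a).
Proof.
move=> Ka /not_killer0[y my ay]; apply: (killer_step my _ ay).
by apply: contrapT => yt; apply: ay; apply: Ka.
Qed.

Lemma killer_type_nonempty (t : simple_type R) :
  exists2 b, killer [set sval t] b & ~ killer set0 b.
Proof.
have [mt rt] := svalP t.
have [||b Kb nK] := @killer_step [set sval t] 1 (sval t) mt.
- exact: rt.
- by rewrite mul1r; case: mt.
- by exists b => //; rewrite -[b]mulr1.
Qed.

Section OneType.
Variable t0 : simple_type R.
Let B := [set sval t0].

(** Left multiplication by [a] sends the homogeneous component of type [t0] into a finitely
    generated semisimple right ideal. *)
Let finite_rank a := exists2 l : seq R, minimal0_seq l &
  forall y, minimal y -> B (rep y) -> rspan l (a * y).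

Let finite_rank_killer a := killer B a /\ finite_rank a.

Let finite_rank_socle a l : (forall y, minimal y -> B (rep y) -> rspan l (a * y)) ->
  forall p, socle B p -> rspan l (a * p).
Proof.
move=> la _ [s sB ->]; have [l0 lD _] := rspan_right_ideal l.
rewrite mulr_sumr big_seq; apply: (@big_ind _ (rspan l)) => // x /sB[->|[mx Bx]].
  by rewrite mulr0.
exact: la.
Qed.

Let finite_rank_two_sided : two_sided finite_rank_killer.
Proof.
have [K0 KB Kl Kr] := killer_two_sided B; split.
- by split=> //; exists [::] => // y _ _; rewrite mul0r.
- move=> a b [Ka [l ml la]] [Kb [l' ml' lb]]; split; first exact: KB.
  exists (l ++ l'); first exact: minimal0_seq_cat.
  move=> y my By; rewrite mulrBl; apply: right_idealB.
  + exact: rspan_right_ideal.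
  + by apply: rspanS (la y my By) => z; rewrite mem_cat => ->.
  + by apply: rspanS (lb y my By) => z; rewrite mem_cat orbC => ->.
- move=> r a [Ka [l ml la]]; split; first exact: Kl.
  exists [seq r * x | x <- l].
    by move=> _ /mapP[x /ml mx ->]; apply: minimal0_mull.
  by move=> y my By; rewrite -mulrA; apply/rspan_mull/la.
- move=> a r [Ka [l ml la]]; split; first exact: Kr.
  exists l => // y my By; rewrite -mulrA; have [->|/eqP ry] := eqVneq (r * y) 0.
    by rewrite mulr0; case: (rspan_right_ideal l).
  by apply: la; [exact: minimal_mull|rewrite rep_mull].
Qed.

(* A hyperplane of the homogeneous component, containing the other components,
   is an annihilator: this produces left multiplications of rank one. *)
Let rank_one y0 : minimal y0 -> B (rep y0) ->
  exists2 b, finite_rank_killer b & b * y0 <> 0.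
Proof.
move=> my0 By0; have [|W [rW sW Wy0 maxW]] :=
    maximal_avoiding (socle_right_ideal (~` B)) (y0 := y0).
  by move=> /(socle_minimal my0).
have [s Hs] := CF_annihilator CF rW.
have [b bs by0] : exists2 b, b \in s & b * y0 <> 0.
  apply: contrapT => nb; apply: Wy0; apply/Hs => x xs.
  by apply: contrapT => xy; apply: nb; exists x.
have bW w : W w -> b * w = 0 by move=> /Hs/(_ b bs).
exists b => //; split.
  by move=> x mx Bx; apply/bW/sW/socle_typed; right.
exists [:: b * y0].
  by move=> x; rewrite inE => /eqP->; apply: minimal0_mull; case: my0.
move=> y [y0' my] By /=.
have [Wy|Wy] := pselect (W y); first by exists 0; rewrite mulr0 subr0 bW.
have [W0 WD WM] := rW.
(* By maximality of [W], [y0] lies in [W + y R]; since [b] kills [W], it follows that [b y] lies in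
   [b y0 R]. *)
pose N a := exists w r, W w /\ a = w + y * r.
have [w [r [Ww e]]] : N y0.
  apply: contrapT => Ny0; apply: Wy; apply: (maxW N) => //.
  - split; first by exists 0, 0; rewrite mulr0 addr0.
      move=> _ _ [m [r [Mm ->]]] [m' [r' [Mm' ->]]]; exists (m + m'), (r + r').
      by split; [exact: WD | rewrite mulrDr addrACA].
    move=> _ q [m [r [Mm ->]]]; exists (m * q), (r * q).
    by split; [exact: WM | rewrite mulrDl mulrA].
  - by move=> m Wm; exists m, 0; rewrite mulr0 addr0.
  - by exists 0, 1; rewrite mulr1 add0r.
have byr : b * y0 = b * y * r by rewrite e mulrDr bW // add0r mulrA.
have [|d yrd] := my r.
  by apply/eqP => yr; apply: by0; rewrite byr -mulrA yr mulr0.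
by exists d; rewrite byr -!mulrA (mulrA y) yrd subrr.
Qed.

(** The [xs] have no common zero on the component, so the image [P] of the component under [a] meets
    their annihilator in zero, and [finitely_generated_lift] applies to [P]. *)
Let finite_rank_descend a (xs : seq R) :
  (forall y, minimal y -> B (rep y) -> exists2 x, x \in xs & x * y <> 0) ->
  (forall x, x \in xs -> finite_rank (x * a)) -> finite_rank a.
Proof.
move=> sep fxa; have [s0 sD sM] := socle_right_ideal B.
pose P := [set a * p | p in socle B].
have PB : P `<=` socle B by move=> _ [p Bp <-]; apply: socle_mull.
have [|x xxs||t tP Pt] := @finitely_generated_lift R P xs.
- split; first by exists 0; rewrite ?mulr0.
    by move=> _ _ [p Bp <-] [q Bq <-]; exists (p + q); [exact: sD|rewrite mulrDr].
  by move=> _ r [p Bp <-]; exists (p * r); [exact: sM|rewrite mulrA].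
- have [l ml la] := fxa x xxs; exists l => // _ [p Bp <-]; rewrite mulrA.
  exact: (finite_rank_socle la).
- exists [::] => // q [Pq xsq]; apply: contrapT => q0.
  have [c mqc] := socle_minimal_multiple (PB _ Pq) q0.
  have Bqc : B (rep (q * c)) by apply: (socle_minimal mqc); apply/sM/PB.
  by have [x xxs] := sep _ mqc Bqc; rewrite mulrA xsq // mul0r.
have [|t' t'B tt'] := @socle_span R B t; first by move=> x /tP/PB.
exists t'; first exact: typed_minimal0_seq t'B.
by move=> y my By; apply/tt'/Pt; exists y => //; apply: socle_typed; right.
Qed.

(** If 1 had infinite rank, the ideal of elements of finite rank would cut the layer of [t0] in two.
    With one layer for each other type, this makes one layer more than there are types. *)
Lemma homogeneous_socle_span : exists2 l : seq R, minimal0_seq l & socle B `<=` rspan l.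
Proof.
apply: contrapT => nl.
have nf1 : ~ finite_rank 1.
  move=> [l ml la]; apply: nl; exists l => // p Bp.
  by rewrite -[p]mul1r; apply: (finite_rank_socle la).
have [xs xsK sep] := killer_separates CF B.
have K0F : killer set0 `<=` finite_rank_killer.
  move=> a Ka; split; first by apply: killerS Ka.
  by exists [::] => // y my _; rewrite Ka.
(* [None] is the lower half of the layer of [t0], and [Some t0] the upper half. *)
pose K1 (o : option (simple_type R)) := if o is Some t then
  if pselect (t = t0) then finite_rank_killer else killer set0 else killer set0.
pose K2 (o : option (simple_type R)) := if o is Some t then killer [set sval t]
  else finite_rank_killer.
have K01 o : killer set0 `<=` K1 o.
  by case: o => [t|] a Ka //=; case: (pselect (t = t0)) => e //; apply: K0F.
have [mt0 rt0] := svalP t0.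
have [||||||g [gI _]] := @simple_type_injection R CF hT (option (simple_type R)) K1 K2.
- case=> [t|] /=; last exact: killer_two_sided.
  by case: (pselect (t = t0)) => e;
    [exact: finite_rank_two_sided|exact: killer_two_sided].
- by case=> [t|] /=; [exact: killer_two_sided|exact: finite_rank_two_sided].
- by move=> o z Zz; apply/K01/killer_singular.
- case=> [t|] /=.
    case: (pselect (t = t0)) => /= [->|e]; last exact: killer_type_nonempty.
    apply: contrapT => nK; apply: nf1; apply: (finite_rank_descend sep) => x xxs.
    rewrite mulr1; apply: contrapT => fx; apply: nK; exists x; first exact: xsK.
    by move=> [].
  have [b Fb bt0] := rank_one mt0 rt0; exists b => // Kb.
  by apply: bt0; apply: Kb.
- case=> [t|] a /=.
    case: (pselect (t = t0)) => /= [->|e]; last exact: killer_type_step.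
    move=> Ka fa; apply: contrapT => nK; apply: fa; split=> //.
    apply: (finite_rank_descend sep) => x xxs.
    apply: contrapT => fx; apply: nK; exists x; first exact: xsK.
    by move=> [].
  move=> [Ka _] /not_killer0[y my ay].
  have By : B (rep y) by apply: contrapT => By; apply: ay; apply: Ka.
  have [|b Fb bay] := rank_one (minimal_mull my ay); first by rewrite rep_mull.
  exists b => // Kb; apply: bay; rewrite mulrA; exact: Kb.
- have [_ _ Fl Fr] := finite_rank_two_sided.
  move=> [t|] [t'|] // tt'.
  + left=> a b /= Ka Kb; apply: (K01 (Some t)).
    by apply: killerI0 Ka Kb; apply: simple_type_sval_neq => e; apply: tt'; rewrite e.
  + have [e|ne] := pselect (t = t0).
      left=> a b /= Ka Fb; case: (pselect (t = t0)) => // e'; exact: Fl.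
    right=> a b /= Ka [Kb _]; apply: killerI0 Ka Kb.
    exact: simple_type_sval_neq.
  + have [e|ne] := pselect (t' = t0).
      right=> a b /= Fa Kb; case: (pselect (t' = t0)) => // e'; exact: Fr.
    left=> a b /= [Ka _] Kb; apply: killerI0 Ka Kb.
    by apply: simple_type_sval_neq => e; apply: ne.
exact: no_option_injection gI.
Qed.

End OneType.

Lemma socle_finitely_spanned :
  exists2 l : seq R, minimal0_seq l & socle setT `<=` rspan l.
Proof.
have [ts [tsm tsr]] := finite_simple_types CF hT.
have [l ml lts] : exists2 l : seq R, minimal0_seq l &
    forall y, minimal y -> rep y \in ts -> rspan l y.
  elim: ts tsm {tsr} => [|t ts IH] tsm; first by exists [::].
  have [|l ml lts] := IH; first by move=> y yt; apply: tsm; rewrite in_cons yt orbT.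
  have pt := tsm t (mem_head _ _).
  have [l' ml' l't] := homogeneous_socle_span (exist _ t pt).
  exists (l' ++ l); first exact: minimal0_seq_cat.
  move=> y my; rewrite in_cons => /predU1P[yt|yts].
    apply: (@rspanS _ l') => [z|]; first by rewrite mem_cat => ->.
    by apply/l't/socle_typed; right; split.
  apply: (@rspanS _ l) => [z|]; first by rewrite mem_cat orbC => ->.
  exact: lts.
exists l => // _ [s sT ->]; have [l0 lD _] := rspan_right_ideal l.
rewrite big_seq; apply: (@big_ind _ (rspan l)) => // x /sT[->//|[mx _]].
by apply: lts => //; apply: tsr.
Qed.

Lemma singular_two_sided : two_sided (fun z => z \in Z).
Proof.
split; first exact: rpred0.
- by move=> x y; apply: rpredB.
- exact: right_singular_mull.
- exact: right_singular_mulr.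
Qed.

(** A finite intersection of essential right ideals is essential, so it meets [b R]. *)
Lemma singular_common_multiple (xs : seq R) b : (forall x, x \in xs -> x \in Z) ->
  b != 0 -> exists2 c, b * c != 0 & forall x, x \in xs -> x * (b * c) = 0.
Proof.
elim: xs b => [|x xs IH] b xsZ b0; first by exists 1; rewrite ?mulr1.
have [|c bc xsc] := IH b _ b0; first by move=> y yx; apply: xsZ; rewrite in_cons yx orbT.
have /right_singularP Hx := xsZ x (mem_head _ _).
pose N : {pred right_regular R} := [pred a | `[< exists r, a = b * c * r >]].
have [||a [xa /asboolP[r ar] a0]] := Hx N.
- split; first by apply/asboolP; exists 0; rewrite mulr0.
  move=> e _ _ /asboolP[u ->] /asboolP[v ->]; apply/asboolP.
  by exists (u * e + v); rewrite mulrDr mulrA.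
- by exists (b * c) => //; apply/asboolP; exists 1; rewrite mulr1.
exists (c * r); first by rewrite mulrA -ar.
move=> y; rewrite in_cons (mulrA b) => /predU1P[->|yxs]; first by rewrite -ar.
by rewrite mulrA xsc // mul0r.
Qed.

(** If [a0 R] contained no simple module, [killer set0] over Z(R_R) would be a layer in addition to
    those of the types. It is nonzero: were all [xs] singular, some nonzero multiple of [a0] would
    be killed by them and so lie in the socle. *)
Lemma socle_essential a0 : a0 <> 0 -> exists c : R, minimal (a0 * c).
Proof.
move=> a00; apply: contrapT => na0.
have [xs Hxs] := CF_annihilator CF (@socle_right_ideal R setT).
have xsK x : x \in xs -> killer set0 x.
  by move=> xxs y my _; apply: (Hxs y).1 => //; apply: socle_typed; right.
pose K1 (o : option (simple_type R)) := if o is Some t then killer set0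
  else (fun z => z \in Z).
pose K2 (o : option (simple_type R)) := if o is Some t then killer [set sval t]
  else killer set0.
have [||||||g [gI _]] := @simple_type_injection R CF hT (option (simple_type R)) K1 K2.
- by case=> [t|] /=; [exact: killer_two_sided|exact: singular_two_sided].
- by case=> [t|] /=; exact: killer_two_sided.
- by case=> [t|] z Zz //=; apply: killer_singular.
- case=> [t|] /=; first exact: killer_type_nonempty.
  apply: contrapT => nK.
  have [x xxs||c a0c xsc] := @singular_common_multiple xs a0.
  + by apply: contrapT => Zx; apply: nK; exists x => //; apply: xsK.
  + exact/eqP.
  have [|d md] := socle_minimal_multiple ((Hxs (a0 * c)).2 xsc); first exact/eqP.
  by apply: na0; exists (c * d); rewrite mulrA.
- case=> [t|] a /=; first exact: killer_type_step.
  move=> Ka Za; apply: contrapT => nK.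
  have [N [sN [b bN b0] Na]] : exists N : {pred right_regular R},
      [/\ submod_closed N, exists2 b : R, b \in N & b != 0 &
       forall b : R, b \in N -> a * b = 0 -> b = 0].
    apply: contrapT => nN; apply: Za; apply/right_singularP => N sN N0.
    apply: contrapT => nb; apply: nN; exists N; split=> // b bN ab.
    by apply: contrapT => /eqP b0; apply: nb; exists b.
  have [_ _ NM] := submod_right_ideal sN.
  have [x|c bc xsc] := @singular_common_multiple [seq x * a | x <- xs] b _ b0.
    move=> /mapP[y yxs ->]; apply: contrapT => Zya; apply: nK.
    by exists y => //; apply: xsK.
  have sabc : socle setT (a * (b * c)).
    by apply/Hxs => x xxs; rewrite (mulrA x); apply/xsc/mapP; exists x.
  have [|d md] := socle_minimal_multiple sabc.
    by move=> /Na => /(_ (NM _ _ bN)) e; rewrite e eqxx in bc.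
  pose y := b * c * d; have Ny : y \in N by apply/NM/NM.
  have ay : a * y <> 0 by rewrite /y mulrA; case: md.
  suff my : minimal y by apply: ay; apply: Ka.
  split=> [y0|e ye]; first by apply: ay; rewrite y0 mulr0.
  have [_ may] := md; have [|f yef] := may e.
    rewrite -!mulrA !(mulrA b) !(mulrA (b * c)) -/y.
    by apply: contraNneq ye => /Na-> //; apply: NM.
  exists f; apply/eqP; rewrite -subr_eq0; apply/eqP/Na.
    have := right_idealB (submod_right_ideal sN); apply=> //.
    by apply/NM/NM.
  by rewrite mulrBr /y !mulrA; rewrite !mulrA in yef; rewrite yef subrr.
- have K0 := killer_two_sided (set0 : set R); case: K0 => _ _ K0l K0r.
  move=> [t|] [t'|] // tt'.
  + left=> a b /= Ka Kb.
    by apply: killerI0 Ka Kb; apply: simple_type_sval_neq => e; apply: tt'; rewrite e.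
  + by left=> a b /= Ka Kb; apply: K0l.
  + by right=> a b /= Ka Kb; apply: K0r.
exact: no_option_injection gI.
Qed.

End FiniteSocle.

(** * Right artinian rings *)

Section Chains.
Variable R : pzRingType.
Implicit Types (N : nat -> set R) (t xs : seq R).

Lemma decreasing_le N : (forall n, N n.+1 `<=` N n) ->
  forall m n, (m <= n)%N -> N n `<=` N m.
Proof.
move=> Nd m n /subnKC <-; elim: (n - m)%N => [|k IH]; first by rewrite addn0.
by rewrite addnS; apply: subset_trans IH; apply: Nd.
Qed.

(** Once the intersections with the span of the tail are stable, either some [N m] lies in that
    span, or every [N n] contains a [p] outside it, and subtracting a multiple of [p] moves any
    element of [N n1] into the span. *)
Lemma rspan_chain_stable N t : minimal0_seq t -> (forall n, right_ideal (N n)) ->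
  (forall n, N n.+1 `<=` N n) -> N 0%N `<=` rspan t ->
  exists n0, forall n, (n0 <= n)%N -> N n0 `<=` N n.
Proof.
elim: t N => [|x t IH] N mt rN Nd Nt.
  exists 0%N => n _ a /Nt /= ->; by case: (rN n).
have mt' : minimal0_seq t by move=> y yt; apply: mt; rewrite in_cons yt orbT.
have rt := rspan_right_ideal t; have [t0 tD tM] := rt.
have [n1 Hn1] : exists n0, forall n, (n0 <= n)%N ->
    N n0 `&` rspan t `<=` N n `&` rspan t.
  apply: (IH (fun n => N n `&` rspan t) mt') => [n|n a [/Nd Na ta]|a []//].
    have [N0 ND NM] := rN n; split=> // [a b [Na ta] [Nb tb]|a r [Na ta]].
      by split; [exact: ND|exact: tD].
    by split; [exact: NM|exact: tM].
  by split.
have Nle := decreasing_le Nd.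
have [[m Nm]|nm] := pselect (exists m, N m `<=` rspan t).
  exists (maxn m n1) => n; rewrite geq_max => /andP[mn n1n] a Na.
  have /Hn1 : (n1 <= n)%N by []; move=> /(_ a) [] //; split.
    by apply: Nle Na; rewrite leq_maxr.
  by apply: Nm; apply: Nle Na; rewrite leq_maxl.
exists n1 => n n1n a Na.
have /existsNP[p /not_implyP[Np tp]] : ~ N n `<=` rspan t.
  by move=> H; apply: nm; exists n.
have [r pr] : rspan (x :: t) p by apply: Nt; apply: Nle Np.
have [r' ar'] : rspan (x :: t) a by apply: Nt; apply: Nle Na.
have xr0 : x * r != 0 by apply/eqP => xr0; apply: tp; rewrite -[p]subr0 -xr0.
have [d xrd] := mt x (mem_head _ _) r xr0.
have [_ ND NM] := rN n.
rewrite -(subrK (p * (d * r')) a); apply: ND; last exact: NM.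
have /Hn1 := n1n; move=> /(_ (a - p * (d * r')))[] //; split.
  apply: (right_idealB (rN n1)) => //; apply: (Nle _ _ n1n); exact: NM.
have -> : a - p * (d * r') = (a - x * r') - (p - x * r) * (d * r').
  by rewrite mulrBl mulrA (mulrA (x * r)) xrd opprB addrA subrK -mulrA.
by apply: (right_idealB rt) => //; apply: tM.
Qed.

(** The image of the chain in a finite power of the semisimple [rspan t], with coordinates [x a],
    becomes stationary. *)
Lemma chain_stable_modulo N xs t : minimal0_seq t ->
  (forall n, right_ideal (N n)) -> (forall n, N n.+1 `<=` N n) ->
  (forall x a, x \in xs -> N 0%N a -> rspan t (x * a)) ->
  exists n0, forall n, (n0 <= n)%N -> forall a, N n0 a ->
    exists2 a', N n a' & forall x, x \in xs -> x * (a - a') = 0.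
Proof.
move=> mt; elim: xs N => [|x xs IH] N rN Nd xN.
  by exists 0%N => n _ a _; exists 0 => //; case: (rN n).
have Nle := decreasing_le Nd.
have [|||n1 Hn1] := @rspan_chain_stable (fun n => [set x * a | a in N n]) t mt.
- move=> n; have [N0 ND NM] := rN n; split; first by exists 0; rewrite ?mulr0.
    by move=> _ _ [a Na <-] [b Nb <-]; exists (a + b); [exact: ND|rewrite mulrDr].
  by move=> _ r [a Na <-]; exists (a * r); [exact: NM|rewrite mulrA].
- by move=> n _ [a /Nd Na <-]; exists a.
- by move=> _ [a Na <-]; apply: xN; rewrite ?mem_head.
have [|||n2 Hn2] := IH (fun n => N n `&` [set a | x * a = 0]).
- move=> n; have [N0 ND NM] := rN n.
  split=> [|a b [Na xa] [Nb xb]|a r [Na xa]].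
  + by split=> //=; rewrite mulr0.
  + by split; [exact: ND|rewrite /= mulrDr xa xb addr0].
  + by split; [exact: NM|rewrite /= mulrA xa mul0r].
- by move=> n a [/Nd].
- by move=> y a yxs [Na _]; apply: xN => //; rewrite in_cons yxs orbT.
exists (maxn n1 n2) => n; rewrite geq_max => /andP[n1n n2n] a Na.
have [|a1 Na1 xa1] := Hn1 n n1n (x * a).
  by exists a => //; apply: Nle Na; rewrite leq_maxl.
have [|a2 [Na2 xa2] xsa2] := Hn2 n n2n (a - a1).
  split; last by rewrite /= mulrBr xa1 subrr.
  apply: (right_idealB (rN n2)); last exact: (Nle _ _ n2n).
  by apply: Nle Na; rewrite leq_maxr.
exists (a1 + a2); first by case: (rN n) => _ ND _; apply: ND.
move=> y; rewrite opprD addrA in_cons => /predU1P[->|/xsa2//].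
by rewrite mulrBr xa2 subr0 mulrBr xa1 subrr.
Qed.

End Chains.

Section Artinian.
Variable R : pzRingType.
Hypothesis CF : right_CF R.
Hypothesis socle_fg : exists2 l : seq R, minimal0_seq l & socle setT `<=` rspan l.
Hypothesis socle_ess : forall a : R, a <> 0 -> exists c : R, minimal (a * c).

(** The socle of a finite power of [R] is essential: a nonzero tuple of the [x a] has a nonzero
    multiple with all entries in the socle. *)
Lemma common_socle_multiple (xs : seq R) a : exists c,
  (forall x, x \in xs -> socle setT (x * (a * c))) /\
  forall x, x \in xs -> x * a <> 0 -> exists2 y, y \in xs & y * (a * c) <> 0.
Proof.
have [S0 SD SM] := @socle_right_ideal R setT.
elim: xs => [|x xs [c [xsc xsn]]]; first by exists 1.
have [xs0|/existsNP[y /not_implyP[yxs yac]]] :=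
    pselect (forall y, y \in xs -> y * (a * c) = 0).
  have xsa y : y \in xs -> y * a = 0.
    by move=> yxs; apply: contrapT => /(xsn y yxs)[z /xs0].
  have [xa|/eqP xa] := eqVneq (x * a) 0.
    exists 0; split=> y; first by rewrite !mulr0.
    by rewrite in_cons => /predU1P[->|/xsa ->].
  have [d md] := socle_ess xa.
  exists d; split=> y; rewrite in_cons => /predU1P[->|yxs].
  - by rewrite mulrA; apply: socle_typed; right.
  - by rewrite mulrA xsa // mul0r.
  - by exists x; rewrite ?mem_head // mulrA; case: md.
  - by rewrite xsa.
have [xac|/eqP xac] := eqVneq (x * (a * c)) 0.
  exists c; split=> z; rewrite in_cons => /predU1P[->|zxs].
  - by rewrite xac.
  - exact: xsc.
  - by exists y; rewrite ?in_cons ?yxs ?orbT.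
  - by exists y; rewrite ?in_cons ?yxs ?orbT.
have [d md] := socle_ess xac.
have e : x * (a * c) * d = x * (a * (c * d)) by rewrite !mulrA.
rewrite e in md; exists (c * d); split=> z; rewrite in_cons => /predU1P[->|zxs].
- by apply: socle_typed; right.
- by rewrite mulrA (mulrA (z * a)) -(mulrA z); apply/SM/xsc.
- by exists x; rewrite ?mem_head //; case: md.
- by exists x; rewrite ?mem_head //; case: md.
Qed.

(** Let [xs] have the intersection of the chain as annihilator. The terms [N' n], which [xs] sends
    into the socle, become stationary, hence reach the intersection; as the socle is essential, so
    does [N n0]. *)
Lemma right_artinian_of_socle : right_artinian R.
Proof.
move=> N sN Nd.
pose M n : set R := fun a => a \in N n.
have rN n : right_ideal (M n) := submod_right_ideal (sN n).
have Nd' n : M n.+1 `<=` M n by exact: Nd.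
have Nle := decreasing_le Nd'.
have [xs Hxs] : exists s : seq R, forall a : R,
    (forall n, a \in N n) <-> forall x, x \in s -> x * a = 0.
  apply: (CF_annihilator CF); split=> [n|a b Na Nb n|a r Na n].
  - by case: (rN n) => M0 _ _; exact: M0.
  - by case: (rN n) => _ MD _; apply: (MD a b (Na n) (Nb n)).
  - by case: (rN n) => _ _ MM; apply: (MM a r (Na n)).
have [S0 SD SM] := @socle_right_ideal R setT.
pose N' n : set R := fun a => a \in N n /\ forall x, x \in xs -> socle setT (x * a).
have [l ml sl] := socle_fg.
have [|||n0 Hn0] := @chain_stable_modulo R N' xs l ml.
- move=> n; have [N0 ND NM] := rN n; split.
  + by split=> // x _; rewrite mulr0.
  + move=> a b [Na sa] [Nb sb]; split; first exact: ND.
    by move=> x xxs; rewrite mulrDr; apply: SD; [exact: sa|exact: sb].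
  + move=> a r [Na sa]; split; first exact: NM.
    by move=> x xxs; rewrite mulrA; apply/SM/sa.
- by move=> n a [Na sa]; split=> //; apply: Nd'.
- by move=> x a xxs [_ sa]; apply/sl/sa.
have {}Hn0 a : N' n0 a -> forall x, x \in xs -> x * a = 0.
  move=> Na; apply/Hxs => n.
  have [m0|m0] := leqP n0 n; last by apply: (Nle _ _ (ltnW m0)); case: Na.
  have [a' [Na' _] /Hxs/(_ n) aa'] := Hn0 n m0 a Na.
  by have [_ ND _] := rN n; rewrite -(subrK a' a); apply: ND.
have Nall (a : R) : a \in N n0 -> forall n, a \in N n.
  move=> Na; apply/Hxs => x xxs; apply: contrapT => xa.
  have [c [sc nc]] := common_socle_multiple xs a.
  have [y yxs] := nc x xxs xa; apply; apply: Hn0 => //.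
  by split=> //; have [_ _ NM] := rN n0; apply: NM.
exists n0 => n n0n a; apply/idP/idP => [|Na]; last exact: Nall.
exact: (Nle _ _ n0n).
Qed.

End Artinian.

Theorem right_artinian_of_CF (R : pzRingType) : right_CF R ->
  completely_right_T_nilpotent_radical (singular_quotient R) ->
  right_artinian R.
Proof.
move=> CF hT; apply: (right_artinian_of_socle CF).
  exact: socle_finitely_spanned.
by move=> a; apply: socle_essential.
Qed.

(** * The left Kasch property *)

Lemma right_artinian_minimal (R : pzRingType) (P : set (set R)) :
  right_artinian R -> (forall I, P I -> right_ideal I) -> (exists I, P I) ->
  exists I, P I /\ forall J, P J -> J `<=` I -> I `<=` J.
Proof.
move=> artR rP [I0 PI0]; apply: contrapT => nmin.
have /choice[next nextP] (I : set R) : exists J, P I -> [/\ P J, J `<=` I & ~ I `<=` J].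
  have [PI|nPI] := pselect (P I); last by exists I.
  apply: contrapT => nJ; apply: nmin; exists I; split=> // J PJ JI.
  by apply: contrapT => nIJ; apply: nJ; exists J => _.
pose N n := iter n next I0; have PN n : P (N n).
  by elim: n => //= n IH; have [] := nextP _ IH.
have [n|n a /asboolP|n0 Hn0] :=
    artR (fun n => [pred a | `[< N n a >]] : {pred right_regular R}).
- exact/right_ideal_submod/rP.
- by move=> Na; apply/asboolP; have [_ NN _] := nextP _ (PN n); apply: NN.
have [_ _] := nextP _ (PN n0); apply => a Na.
have := Hn0 n0.+1 (leqnSn _) a; rewrite !inE => e.
by apply/asboolP; rewrite e; apply/asboolP.
Qed.

Lemma quotient_ring_projection (R : pzRingType) (I : set R) : two_sided I ->
  exists (B : pzRingType) (p : {rmorphism R -> B}), forall x, p x = 0 <-> I x.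
Proof.
move=> sI; pose p := \pi_(quotient_ring sI).
have pB : zmod_morphism p.
  by move=> x y; rewrite /p (Quotient.pi_add _ x (- y)) (Quotient.pi_opp _ y).
have pM : monoid_morphism p by split=> // x y; rewrite /p pi_ringM.
pose add := GRing.isZmodMorphism.Build _ _ p pB.
pose mult := GRing.isMonoidMorphism.Build _ _ p pM.
pose F : {rmorphism R -> quotient_ring sI} := HB.pack p add mult.
by exists (quotient_ring sI), F => x; apply: pi_ring_eq0.
Qed.

Definition left_ideal (R : pzRingType) (L : set R) :=
  [/\ L 0, forall a b, L a -> L b -> L (a + b) & forall r a, L a -> L (r * a)].

Section LeftKasch.
Variable R : pzRingType.
Hypothesis CF : right_CF R.
Hypothesis artR : right_artinian R.

(* The Jacobson radical, since every simple right module embeds in [R]. *)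
Let J : set R := fun j => forall x, minimal x -> x * j = 0.

Let J_two_sided : two_sided J.
Proof.
split=> [x _|a b Ja Jb x mx|r a Ja x mx|a r Ja x mx].
- exact: mulr0.
- by rewrite mulrBr Ja // Jb // subrr.
- rewrite mulrA; have [->|/eqP xr] := eqVneq (x * r) 0; first exact: mul0r.
  by apply: Ja; apply: minimal_mulr.
- by rewrite mulrA Ja // mul0r.
Qed.

Let not_J a : ~ J a -> exists2 x, minimal x & x * a <> 0.
Proof.
move=> Ja; apply: contrapT => nx; apply: Ja => x mx.
by apply: contrapT => xa; apply: nx; exists x.
Qed.

(** If [k] is 1 modulo [J] and has no right inverse, [k R] is killed by a minimal [x], and
    [x = x (1 - k) + x k = 0]. A right inverse of [l] is again 1 modulo [J], so it is a two-sided
    inverse. *)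
Lemma left_inverse_mod_radical l : J (1 - l) -> exists w, w * l = 1.
Proof.
have rinv k : J (1 - k) -> exists w, k * w = 1.
  move=> Jk; apply: contrapT => nw.
  have [||W [rW kW W1 maxW]] := @maximal_avoiding R [set k * w | w in setT] 1.
  - split; first by exists 0; rewrite ?mulr0.
      by move=> _ _ [a _ <-] [b _ <-]; exists (a + b); rewrite ?mulrDr.
    by move=> _ r [a _ <-]; exists (a * r); rewrite ?mulrA.
  - by move=> [w _ e]; apply: nw; exists w.
  have [|x [mx xW]] := maximal_annihilator CF (M := W).
    split=> // N rN WN; have [N1|N1] := pselect (N 1); [by right|left].
    exact: maxW.
  apply: W1; apply/xW; rewrite -(subrK k 1) mulrDr Jk // add0r.
  by apply/xW/kW; exists 1; rewrite ?mulr1.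
move=> Jl; have [w lw] := rinv l Jl.
have [_ JB Jl' Jr'] := J_two_sided.
have [|v wv] := rinv w.
  have -> : 1 - w = 0 - (1 - l) * w by rewrite mulrBl lw mul1r sub0r opprB.
  by apply: (JB); [case: J_two_sided|apply: Jr'].
by exists w; have -> : l = v by rewrite -[l]mulr1 -wv mulrA lw mul1r.
Qed.

(* A minimal right ideal of [R / J] inside [a R + J / J] is generated by an
   idempotent, which transfers to the left ideal [R a]. *)
Let idempotent_below a : ~ J a ->
  exists b, ~ J (b * a) /\ J (b * a * (b * a) - b * a).
Proof.
move=> Ja; have [B [p pJ]] := quotient_ring_projection J_two_sided.
pose I c : set R := fun z => exists r, J (z - a * c * r).
have rI c : right_ideal (I c).
  have [J0 JB _ Jr] := J_two_sided; split; first by exists 0; rewrite mulr0 subr0.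
    move=> u v [r ur] [q vq]; exists (r + q).
    rewrite mulrDr opprD addrACA -[v - _]opprK; apply: (JB) => //.
    by rewrite -[- _]sub0r; apply: (JB).
  by move=> u q [r ur]; exists (r * q); rewrite mulrA -mulrBl; apply: Jr.
have [||_ [[c Jac <-] minI]] :=
    @right_artinian_minimal R [set I c | c in [set c | ~ J (a * c)]] artR.
- by move=> _ [c _ <-].
- by exists (I 1), 1; rewrite //= mulr1.
have [x [x0 mx] xac] := not_J Jac; set m := a * c in Jac xac minI.
have [b xmb] : exists b, x * m * b = x by apply: mx; apply/eqP.
have em : a * (c * (1 - b * m)) = m - m * b * m.
  by rewrite mulrA -/m mulrBr mulr1 mulrA.
(* Otherwise minimality makes [m] a right multiple of [m - m b m] modulo [J]; but [x] kills the
   latter and not [m]. *)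
have Jmbm : J (a * (c * (1 - b * m))).
  apply: contrapT => nJ; have [|||r] := minI (I (c * (1 - b * m))) _ _ m.
  - by exists (c * (1 - b * m)).
  - move=> z [r zr]; exists ((1 - b * m) * r).
    by rewrite mulrA -(mulrA a c).
  - by exists 1; have [J0 _ _ _] := J_two_sided; rewrite mulr1 subrr.
  move/(_ x (conj x0 mx)); rewrite mulrBr => /eqP; rewrite subr_eq0 => /eqP xm.
  apply: xac; rewrite xm em mulrA mulrBr (mulrA x (m * b)) (mulrA x m) xmb.
  by rewrite subrr mul0r.
have pm' : p a * p c = p m by rewrite -rmorphM.
have {}Jac : ~ J m := Jac; clearbody m.
have pm : p m * p b * p m = p m.
  move/pJ: Jmbm; rewrite em rmorphB !rmorphM => /eqP.
  by rewrite subr_eq0 => /eqP.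
(* Modulo [J], with [m = a c] and [m b m = m], the element [c b m b a] is idempotent; it is nonzero
   because [a (c b m b a) c = m]. *)
exists (c * b * m * b); rewrite -!pJ rmorphB !rmorphM.
split.
  move=> e; apply: Jac; apply/pJ; rewrite -pm -{1}pm.
  have : p a * (p c * p b * p m * p b * p a) * p c = 0.
    by rewrite e mulr0 mul0r.
  by rewrite !mulrA -[_ * p a * p c]mulrA pm'.
apply/eqP; rewrite subr_eq0; apply/eqP; rewrite !mulrA.
rewrite -[_ * p a * p c]mulrA pm' -!mulrA; congr (_ * (_ * _)).
by rewrite !mulrA pm pm.
Qed.

(** Take an idempotent [e] of [L] modulo [J] with minimal right annihilator. If [1 - e] is not in
    [J], some idempotent [f] of [L] satisfies [f e = 0], and [e + f - e f] has a smaller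
    annihilator. *)
Lemma left_ideal_mod_radical (L : set R) : left_ideal L ->
  (forall c, (forall u, L u -> J (u * c)) -> J c) -> exists2 l, L l & J (1 - l).
Proof.
move=> [L0 LD LM] HL; have [B [p pJ]] := quotient_ring_projection J_two_sided.
have [J0 JB Jl Jr] := J_two_sided.
pose I e : set R := fun c => J (e * c).
have [||_ [[e [Le Jee] <-] minI]] :=
    @right_artinian_minimal R [set I e | e in [set e | L e /\ J (e * e - e)]] artR.
- move=> _ [e _ <-]; split; first by rewrite /I mulr0.
    move=> a b; rewrite /I mulrDr => Ja Jb; rewrite -[e * b]opprK; apply: (JB) => //.
    by rewrite -[- _]sub0r; apply: (JB).
  by move=> a r; rewrite /I mulrA; apply: Jr.
- by exists (I 0), 0 => //; split=> //; rewrite mulr0 subr0.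
exists e => //; apply: contrapT => nJ.
have [l Ll nJl] : exists2 l, L l & ~ J (l * (1 - e)).
  apply: contrapT => nl; apply: nJ; apply: HL => u Lu.
  by apply: contrapT => nJu; apply: nl; exists u.
have Ll' : L (l * (1 - e)).
  by rewrite mulrBr mulr1 -mulrN; apply: (LD) => //; rewrite mulrN -mulNr; apply: LM.
have [b [nJf Jff]] := idempotent_below nJl.
set f := b * _ in nJf Jff; have Lf : L f by apply: LM.
have pe : p e * p e = p e.
  by move/pJ: Jee; rewrite rmorphB rmorphM => /eqP; rewrite subr_eq0 => /eqP.
have pf : p f * p f = p f.
  by move/pJ: Jff; rewrite rmorphB rmorphM => /eqP; rewrite subr_eq0 => /eqP.
have pfe : p f * p e = 0.
  rewrite /f !rmorphM rmorphB rmorph1 -!mulrA mulrBl mul1r pe subrr.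
  by rewrite !mulr0.
pose e' := e + f - e * f.
have pe' : p e' = p e + p f - p e * p f by rewrite rmorphB rmorphD rmorphM.
have pe'e : p e' * p e = p e.
  by rewrite pe' mulrBl mulrDl -mulrA pe pfe mulr0 addr0 subr0.
have pe'f : p e' * p f = p f.
  by rewrite pe' mulrBl mulrDl -mulrA pf addrAC subrr add0r.
have pee' : p e * p e' = p e.
  by rewrite pe' mulrBr mulrDr mulrA pe addrK.
suff : I e' (1 - e).
  move/pJ; rewrite rmorphM [p (1 - e)]rmorphB rmorph1 mulrBr mulr1 pe'e pe' => e'0.
  apply: nJf; apply/pJ; rewrite -pf.
  have : p f * (p e + p f - p e * p f - p e) = 0 by rewrite e'0 mulr0.
  by rewrite addrAC (addrC (p e)) addrK mulrBr mulrA pfe mul0r subr0.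
apply: minI.
- exists e' => //; split.
    by rewrite /e' -mulNr; apply: (LD); [exact: LD|exact: LM].
  apply/pJ; rewrite rmorphB rmorphM {2}pe' mulrBr mulrDr mulrA pe'e pe'f.
  by rewrite pe' subrr.
- move=> c /pJ; rewrite rmorphM => e'c; apply/pJ; rewrite rmorphM -pee' -mulrA e'c.
  exact: mulr0.
- by apply/pJ; rewrite rmorphM rmorphB rmorph1 mulrBr mulr1 pe subrr.
Qed.

Hypothesis hT : completely_right_T_nilpotent_radical (singular_quotient R).
Local Notation Z := (right_singular_ideal R).

(** Otherwise elements of [J] can be multiplied forever onto the representative of [t] without
    reaching zero, whereas by T-nilpotence some product falls in Z(R_R), which kills minimal
    elements. *)
Let killed_by_radical (t : simple_type R) :
  exists2 y, minimal y /\ rep y = sval t & forall j, J j -> j * y = 0.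
Proof.
apply: contrapT => ny.
have /choice[j Hj] y : exists j, minimal y /\ rep y = sval t -> J j /\ j * y <> 0.
  have [my|nmy] := pselect (minimal y /\ rep y = sval t); last by exists 0.
  apply: contrapT => nj; apply: ny; exists y => // j Jj.
  by apply: contrapT => jy; apply: nj; exists j.
pose y n := iter n (fun y => j y * y) (sval t).
have Hy n : minimal (y n) /\ rep (y n) = sval t.
  elim: n => [|n IH] /=; first by have [mt rt] := svalP t.
  have [_ jy] := Hj _ IH; have [my ry] := IH.
  by split; [exact: minimal_mull|rewrite rep_mull].
have [n M maxM _|n Zn] :=
    T_nilpotent_modulo hT (singular_two_sided R) (fun z h => h) (a := fun n => j (y n)).
  have [x [mx xM]] := maximal_annihilator CF maxM.
  by apply/xM; have [Jj _] := Hj _ (Hy n); apply: Jj.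
have e k : left_prod (fun n => j (y n)) k * sval t = y k.
  by elim: k => [|k IH] /=; rewrite ?mul1r // -mulrA IH.
have [mt _] := svalP t; have [[yn _] _] := Hy n; apply: yn; rewrite -e.
by apply: singular_minimal0 Zn _; case: mt.
Qed.

(* The injection [t |-> x] with [x (killer t) <> 0] is onto, the number of types
   being finite. *)
Let type_bijection : exists g : simple_type R -> simple_type R,
  (forall t, exists2 k, killer [set sval t] k & sval (g t) * k <> 0) /\
  forall x : R, minimal x -> exists t, rep x = sval (g t).
Proof.
have [||||||g [gI gK]] := @simple_type_injection R CF hT (simple_type R)
  (fun=> killer set0) (fun t => killer [set sval t]).
- by move=> _; apply: killer_two_sided.
- by move=> t; apply: killer_two_sided.
- by move=> _ z; apply: killer_singular.
- exact: killer_type_nonempty.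
- by move=> t a; apply: killer_type_step.
- move=> t t' tt'; left=> a b; apply: killerI0.
  exact: simple_type_sval_neq.
exists g; split=> [t|x mx]; first by have [] := gK t.
have [t1 <-] := rep_simple_type mx; apply: contrapT => nt.
pose h o := if o is Some t then g t else t1.
apply: (@no_option_injection R CF hT h); move=> [t|] [t'|] //=.
- by move=> /gI->.
- by move=> e; case: nt; exists t; rewrite e.
- by move=> e; case: nt; exists t'; rewrite e.
Qed.

(** Let [g t] be the type of [x] and [A] the annihilator of the minimal [y] of type [t] with
    [J y = 0]. A simple module killed by [A] has type [g t'], and [t' = t] since [A] contains the
    ideals K_t' for all other [t']. So [x A = 0], and [c] is not in [A]. *)
Let dual_minimal x c : minimal x -> x * c <> 0 ->
  exists y, (forall j, J j -> j * y = 0) /\ c * y <> 0.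
Proof.
move=> mx xc; have [g [gK gsurj]] := type_bijection.
have [t xt] := gsurj x mx.
pose ok y := [/\ minimal y, rep y = sval t & forall j, J j -> j * y = 0].
pose A : set R := fun s => forall y, ok y -> s * y = 0.
have [J0 JB Jl Jr] := J_two_sided.
have sA : two_sided A.
  split=> [y _|a b Aa Ab y oy|r a Aa y oy|a r Aa y [my ry Jy]].
  - exact: mul0r.
  - by rewrite mulrBl Aa // Ab // subrr.
  - by rewrite -mulrA Aa // mulr0.
  - rewrite -mulrA; have [->|/eqP ry0] := eqVneq (r * y) 0; first exact: mulr0.
    apply: Aa; split; [exact: minimal_mull|by rewrite rep_mull|].
    by move=> j Jj; rewrite mulrA; apply/Jy/Jr.
apply: contrapT => ny.
have Ac : A c.
  by move=> y [_ _ Jy]; apply: contrapT => cy; apply: ny; exists y.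
have [|||a _ Aa|M [maxM AM _]] := maximal_between hT sA (K2 := setT).
- by [].
- by move=> z Zz y [[_ my] _ _]; apply: singular_minimal0.
- have [y [my ry] Jy] := killed_by_radical t; exists 1 => //.
  move=> /(_ y); rewrite mul1r => y0; have [+ _] := my; apply; apply: y0.
  by split.
- by exists 1; rewrite ?mul1r.
have [x' [mx' x'M]] := maximal_annihilator CF maxM.
have x'A a : A a -> x' * a = 0 by move=> /AM/x'M.
have [t' x't'] := gsurj x' mx'.
have [mg rg] := svalP (g t').
have tt' : t' = t.
  apply: contrapT => /simple_type_sval_neq tt'; have [k Kk] := gK t'; apply.
  apply: (annihilator_rep (killer_two_sided [set sval t']) mx' mg) Kk.
    by rewrite x't'.
  move=> k' Kk'; apply: x'A => y [my ry _]; apply: Kk' => //.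
  by rewrite ry => e; apply: tt'.
apply: xc; apply: (annihilator_rep sA mx' mx) Ac => //.
by rewrite x't' tt'.
Qed.

(** If [L c] lies in [J] and [c] does not, [dual_minimal] gives [y] with [L c y = 0] and [c y]
    nonzero. Hence [L] contains an element that is 1 modulo [J]. *)
Lemma left_kasch (L : set R) : left_ideal L ->
  (forall c, (forall u, L u -> u * c = 0) -> c = 0) -> L 1.
Proof.
move=> iL rL; have [_ _ LM] := iL.
have [c Lc|l Ll /left_inverse_mod_radical[w <-]] := left_ideal_mod_radical iL.
  apply: contrapT => /not_J[x mx /(dual_minimal mx)[y [Jy]]]; apply.
  by apply: rL => u Lu; rewrite mulrA; apply/Jy/Lc.
exact: LM.
Qed.

End LeftKasch.

(** * Injectivity *)

(* Partial linear maps to [R_R] are represented by their graphs. *)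
Section Injectivity.
Variable R : pzRingType.

Definition baer := forall G : set (R * R),
  G 0 -> (forall p q, G p -> G q -> G (p + q)) ->
  (forall p r, G p -> G (p.1 * r, p.2 * r)) ->
  (forall b, G (0, b) -> b = 0) ->
  exists y, forall a b, G (a, b) -> b = y * a.

Lemma FGF_baer : right_FGF R -> right_artinian R ->
  completely_right_T_nilpotent_radical (singular_quotient R) -> baer.
Proof.
move=> FGF artR hT G G0 GD GM Gf; have CF := FGF_CF FGF.
pose I : set (R * R) := fun p => G (p.2, p.1).
have [|p q|p r|s Hs] := FGF_annihilator2 FGF (I := I).
- exact: G0.
- exact: GD.
- exact: GM.
(* The first coordinates of the relations of the pushout. If [L] kills [c], then [(c, 0)] satisfies
   all relations, so [(0, c)] is in the graph and [c = 0]. *)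
pose L : set R := fun x => exists y, forall a b, G (a, b) -> x * b + y * a = 0.
have L1 : L 1.
  apply: (left_kasch CF artR hT).
    split; first by exists 0 => a b _; rewrite !mul0r addr0.
      move=> x x' [y xy] [y' xy']; exists (y + y') => a b Gab.
      by rewrite !mulrDl addrACA xy // xy' // addr0.
    move=> r x [y xy]; exists (r * y) => a b Gab.
    by rewrite -!mulrA -mulrDr xy // mulr0.
  move=> c Lc; apply: Gf; apply/(Hs c 0) => p ps.
  rewrite mulr0 addr0; apply: Lc; exists p.2 => a b Gab.
  by apply: (Hs b a).1.
have [y Hy] := L1; exists (- y) => a b Gab.
by apply/eqP; rewrite mulNr -addr_eq0 -[b]mul1r Hy.
Qed.

Hypothesis baerR : baer.

Section Extension.
Variable B : lmodType R^c.
Implicit Types G : set (B * R).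

Let submod_graph G := [/\ G 0, forall p q, G p -> G q -> G (p + q),
  forall p (r : R), G p -> G ((r : R^c) *: p.1, p.2 * r) &
  forall v, G (0, v) -> v = 0].

(** Baer's criterion. A maximal graph is total: at a new [b], the [r] with [b r] in its domain form
    a right ideal, and the multiplier [y] of the induced map is the value to take at [b]. *)
Lemma graph_extension G0 : submod_graph G0 ->
  exists h : {linear B -> right_regular R}, forall b v, G0 (b, v) -> h b = v.
Proof.
move=> gG0; pose good G := G0 `<=` G /\ submod_graph G.
have [F FP totF|G [[Ge|[G0G gG]] maxG]] :=
    @Zorn_bigcup _ (fun G => G = set0 \/ good G).
- have [[V [FV gV]]|nV] := pselect (exists V, F V /\ good V); last first.
    left; apply/seteqP; split=> // x [V FV Vx]; have [V0|gV] := FP _ FV.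
      by rewrite V0 in Vx.
    by apply: nV; exists V.
  right; have Fgood U x : F U -> U x -> good U by move=> /FP[->//|].
  have [G0V [V0 VD VM Vf]] := gV.
  split; first by move=> x /G0V Vx; exists V.
  split; first by exists V.
  + move=> p q [U FU Up] [U' FU' U'q]; have [UU|UU] := totF _ _ FU FU'.
      exists U' => //; have [_ [_ D _ _]] := Fgood _ _ FU' U'q.
      by apply: D => //; apply: UU.
    exists U => //; have [_ [_ D _ _]] := Fgood _ _ FU Up.
    by apply: D => //; apply: UU.
  + move=> p r [U FU Up]; exists U => //; have [_ [_ _ M _]] := Fgood _ _ FU Up.
    exact: M.
  + by move=> v [U FU Uv]; have [_ [_ _ _ f]] := Fgood _ _ FU Uv; apply: f.
- exfalso; apply: (maxG G0); last by right; split.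
  by rewrite Ge; split=> // /(_ 0); apply; case: gG0.
have [G00 GD GM Gf] := gG.
have Gneg p : G p -> G (- p).
  move=> /(GM _ (-1)); rewrite mulrN1.
  have -> // : ((-1 : R) : R^c) *: p.1 = - p.1 by exact: scaleN1r.
have Gfun b v w : G (b, v) -> G (b, w) -> v = w.
  move=> Gv /Gneg Gw; apply/eqP; rewrite -subr_eq0; apply/eqP/Gf.
  have := GD _ _ Gv Gw; suff -> : (b, v) + - (b, w) = (0, v - w) by [].
  by congr pair => /=; rewrite subrr.
have Gtot b : exists v, G (b, v).
  pose H : set (R * R) := fun p => G ((p.1 : R^c) *: b, p.2).
  have [||||y Hy] := baerR (G := H).
  - by rewrite /H /= scale0r.
  - move=> p q Hp Hq; rewrite /H /= scalerDl; exact: GD _ _ Hp Hq.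
  - move=> p r Hp; have := GM _ r Hp; rewrite /H /= scalerA; exact.
  - by move=> v; rewrite /H /= scale0r => /Gf.
  exists y; pose G' : set (B * R) := fun p =>
    exists b' v' (r : R), G (b', v') /\ p = (b' + (r : R^c) *: b, v' + y * r).
  have GG' : G `<=` G'.
    move=> [b' v'] Gb'; exists b', v', 0; split=> //.
    by rewrite mulr0 scale0r !addr0.
  have G'b : G' (b, y).
    by exists 0, 0, 1; rewrite mulr1 scale1r !add0r.
  apply: contrapT => nGb; apply: (maxG G'); first by split=> // /(_ _ G'b).
  right; split; first by apply: subset_trans GG'.
  split; first exact: GG'.
  - move=> _ _ [b1 [v1 [r1 [Gb1 ->]]]] [b2 [v2 [r2 [Gb2 ->]]]].
    exists (b1 + b2), (v1 + v2), (r1 + r2); split; first exact: GD Gb1 Gb2.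
    by rewrite scalerDl mulrDr; congr pair; rewrite /= addrACA.
  - move=> _ r [b1 [v1 [r1 [Gb1 ->]]]] /=.
    exists ((r : R^c) *: b1), (v1 * r), (r1 * r).
    split; first exact: GM _ r Gb1.
    by congr pair; [rewrite scalerDr scalerA|rewrite mulrDl mulrA].
  - move=> v [b1 [v1 [r [Gb1 [/eqP + ->]]]]].
    rewrite eq_sym addr_eq0 => /eqP eb1; rewrite eb1 -scaleNr in Gb1.
    by rewrite (Hy (- r) v1 Gb1) mulrN addNr.
have /choice[h hP] := Gtot.
have hlin : linear (h : B -> right_regular R).
  move=> a x y; apply: Gfun (hP _) _.
  exact: (GD _ _ (GM _ (a : R) (hP x)) (hP y)).
pose lin := GRing.isLinear.Build _ _ _ _ (h : B -> right_regular R) hlin.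
pose hl : {linear B -> right_regular R} := HB.pack (h : B -> right_regular R) lin.
by exists hl => b v /G0G Gb; apply: Gfun (hP b) Gb.
Qed.

End Extension.

Lemma baer_injective : injective_module (right_regular R).
Proof.
move=> U B i f iI.
pose G0 : set (B * R) := fun p => exists a, p = (i a, f a).
have [|h hP] := @graph_extension B G0; last by exists h => a; apply: hP; exists a.
split; first by exists 0; rewrite !raddf0.
- by move=> _ _ [a ->] [b ->]; exists (a + b); rewrite !raddfD.
- by move=> _ r [a ->]; exists ((r : R^c) *: a); rewrite !linearZ.
- move=> v [a [/esym e ->]]; suff -> : a = 0 by rewrite raddf0.
  by apply: iI; rewrite raddf0.
Qed.

(** Some nonzero [x] is killed by the annihilator of [w = f v - g v], so sending [w r] to [x r] is
    well defined; it extends to all of [W]. *)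
Lemma baer_cogenerator : right_CF R -> cogenerator (right_regular R).
Proof.
move=> CF V W f g /existsNP[v fgv]; pose w := f v - g v.
have w0 : w <> 0 by move=> /eqP; rewrite subr_eq0 => /eqP.
have [|s Hs] := CF_annihilator CF (I := fun a : R => (a : R^c) *: w = 0).
  split=> [|a b wa wb|a r wa]; first exact: scale0r.
    by have := scalerDl w (a : R^c) (b : R^c); rewrite wa wb addr0.
  by have := scalerA (r : R^c) (a : R^c) w; rewrite wa scaler0.
have [x xs x0] : exists2 x, x \in s & x <> 0.
  apply: contrapT => nx; apply: w0; rewrite -[w]scale1r; apply/Hs => x xs.
  by rewrite mulr1; apply: contrapT => x0; apply: nx; exists x.
pose G0 : set (W * R) := fun p => exists r : R, p = ((r : R^c) *: w, x * r).
have [|h hP] := @graph_extension W G0.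
  split; first by exists 0; rewrite scale0r mulr0.
  - move=> _ _ [a ->] [b ->]; exists (a + b); rewrite mulrDr.
    by have -> := scalerDl w (a : R^c) (b : R^c).
  - move=> _ r [a ->]; exists (a * r); rewrite mulrA.
    by have -> := scalerA (r : R^c) (a : R^c) w.
  - by move=> u [r [/esym/Hs/(_ x xs) xr ->]].
exists h => /(_ v) hfg; apply: x0.
have <- : h w = x by apply: hP; exists 1; rewrite scale1r mulr1.
by rewrite raddfB; apply/eqP; rewrite subr_eq0; apply/eqP.
Qed.

Lemma annihilator_left_principal (x u : R) : (forall c, u * c = 0 -> x * c = 0) ->
  exists y, x = y * u.
Proof.
move=> ux; have [|_ _ [a ->] [b ->]|_ r [a ->]|b [a [/esym/ux e ->]]|y Hy] :=
    baerR (G := fun p => exists a, p = (u * a, x * a)).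
- by exists 0; rewrite !mulr0.
- by exists (a + b); rewrite !mulrDr.
- by exists (a * r); rewrite !mulrA.
- exact: e.
by exists y; apply: Hy; exists 1; rewrite !mulr1.
Qed.

(** The map sending [a + b] to [x a] is well defined on [A + B]; [y] is its multiplier. *)
Lemma annihilator_intersection (A B : set R) (x : R) : right_ideal A -> right_ideal B ->
  (forall c, A c -> B c -> x * c = 0) ->
  exists y, (forall c, B c -> y * c = 0) /\ forall c, A c -> (x - y) * c = 0.
Proof.
move=> rA rB xAB; have [A0 AD AM] := rA; have [B0 BD BM] := rB.
pose G : set (R * R) := fun p => exists a b, [/\ A a, B b & p = (a + b, x * a)].
have [||||y Hy] := baerR (G := G).
- by exists 0, 0; rewrite addr0 mulr0.
- move=> _ _ [a [b [Aa Bb ->]]] [a' [b' [Aa' Bb' ->]]].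
  exists (a + a'), (b + b'); split; [exact: AD|exact: BD|].
  by rewrite mulrDr; congr pair; rewrite /= addrACA.
- move=> _ r [a [b [Aa Bb ->]]]; exists (a * r), (b * r).
  by split; [exact: AM|exact: BM|rewrite /= mulrDl mulrA].
- move=> v [a [b [Aa Bb [/esym/eqP]]]]; rewrite addr_eq0 => /eqP ab ->.
  by apply: xAB => //; rewrite ab -mulrN1; apply: BM.
exists y; split=> c Cc; first by apply/esym/Hy; exists 0, c; rewrite add0r mulr0.
rewrite mulrBl; apply/eqP; rewrite subr_eq0; apply/eqP/Hy.
by exists c, 0; rewrite addr0.
Qed.

Lemma annihilator_left_finite (L : set R) (us : seq R) (x : R) : left_ideal L ->
  (forall u, u \in us -> L u) ->
  (forall c, (forall u, u \in us -> u * c = 0) -> x * c = 0) -> L x.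
Proof.
move=> [L0 LD LM]; elim: us x => [|u us IH] x usL xc.
  by rewrite -[x]mulr1 xc.
have rann (vs : seq R) : right_ideal (fun c => forall v, v \in vs -> v * c = 0).
  split=> [v _|a b va vb v vs'|a r va v vs']; rewrite ?mulr0 //.
    by rewrite mulrDr va // vb // addr0.
  by rewrite mulrA va // mul0r.
have [|y [usy uxy]] := annihilator_intersection (rann [:: u]) (rann us) (x := x).
  move=> c uc usc; apply: xc => v; rewrite in_cons => /predU1P[->|/usc//].
  by apply: uc; rewrite mem_head.
have [c uc|z e] := @annihilator_left_principal (x - y) u.
  by apply: uxy => v; rewrite inE => /eqP->.
rewrite -(subrK y x) e; apply: (LD); first by apply/LM/usL; rewrite mem_head.
by apply: IH usy => v vus; apply: usL; rewrite in_cons vus orbT.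
Qed.

Hypothesis artR : right_artinian R.

(** By the minimal condition the right annihilator of [L] is that of finitely many of its
    elements. *)
Lemma annihilator_left (L : set R) (x : R) : left_ideal L ->
  (forall c, (forall u, L u -> u * c = 0) -> x * c = 0) -> L x.
Proof.
move=> iL Lx; pose ann (us : seq R) : set R := fun c => forall u, u \in us -> u * c = 0.
have [||_ [[us usL <-] minI]] := @right_artinian_minimal R
    [set ann us | us in [set us : seq R | forall u, u \in us -> L u]] artR.
- move=> _ [vs _ <-]; split=> [v _|a b va vb v vs'|a r va v vs']; rewrite ?mulr0 //.
    by rewrite mulrDr va // vb // addr0.
  by rewrite mulrA va // mul0r.
- by exists (ann [::]), [::].
apply: (annihilator_left_finite iL usL) => c usc; apply: Lx => u Lu.
have : ann (u :: us) c; last by apply; rewrite mem_head.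
apply: minI usc; first by exists (u :: us) => // v; rewrite in_cons => /predU1P[->|/usL].
by move=> d ud v vus; apply: ud; rewrite in_cons vus orbT.
Qed.

End Injectivity.

(** * Right noetherian and left artinian rings *)

Section Noetherian.
Variable R : pzRingType.
Hypothesis CF : right_CF R.
Hypothesis artR : right_artinian R.
Hypothesis socle_fg : exists2 l : seq R, minimal0_seq l & socle setT `<=` rspan l.

(* A variant of the socle series: [S n.+1] consists of the elements sent into
   the socle by all homomorphisms from [R / S n] to [R_R]. *)
Let S n : set R := iter n (fun I s => forall y, (forall q, I q -> y * q = 0) ->
  socle setT (y * s)) [set 0].

Let S_two_sided n : right_ideal (S n) /\ forall r s, S n s -> S n (r * s).
Proof.
have [S0 SD SM] := @socle_right_ideal R setT.
elim: n => [|n [rS IH]] /=.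
  split; last by move=> r s ->; rewrite /= mulr0.
  by split=> // [a b -> ->|a r ->]; rewrite /= ?addr0 ?mul0r.
split; first split=> [y _|a b Sa Sb y yS|a r Sa y yS].
- by rewrite mulr0.
- by rewrite mulrDr; apply: (SD); [exact: Sa|exact: Sb].
- by rewrite mulrA; apply/SM/Sa.
move=> r s Ss y yS; rewrite mulrA; apply: Ss => q Sq.
by rewrite -mulrA yS //; apply: IH.
Qed.

Let S_increasing n : S n `<=` S n.+1.
Proof.
by move=> s Ss y yS; rewrite yS //; case: (@socle_right_ideal R setT).
Qed.

(** The left annihilators of the [S n] become stationary, and each [S n] is recovered from its left
    annihilator, so the series stops. If it stopped below [R], a minimal right ideal of [R / S n]
    would lie in the next term. *)
Let S_exhausts : exists n, S n = setT.
Proof.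
pose L n : set R := fun y => forall q, S n q -> y * q = 0.
have rL n : right_ideal (L n).
  split=> [q _|a b La Lb q Sq|a r La q Sq].
  - exact: mul0r.
  - by rewrite mulrDl La // Lb // addr0.
  - by rewrite -mulrA La //; apply: (S_two_sided n).2.
have [||_ [[n _ <-] minL]] := @right_artinian_minimal R [set L n | n in setT] artR.
- by move=> _ [n _ <-].
- by exists (L 0%N), 0%N.
have LS : L n `<=` L n.+1.
  apply: minL; first by exists n.+1.
  by move=> y Ly q /S_increasing/Ly.
have [rS lS] := S_two_sided n; have [xs Hxs] := CF_annihilator CF rS.
have SS : S n.+1 `<=` S n.
  move=> s Ss; apply/Hxs => x xxs; apply: LS Ss => q Sq.
  exact: (Hxs q).1.
exists n; apply/seteqP; split=> // a0 _; apply: contrapT => Sa0.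
have [S0 SD SM] := rS.
pose I a : set R := fun z => exists r, S n (z - a * r).
have [||_ [[a Sa <-] minI]] :=
    @right_artinian_minimal R [set I a | a in [set a | ~ S n a]] artR.
- move=> _ [a _ <-]; split; first by exists 0; rewrite mulr0 subr0.
    move=> u v [r ur] [q vq]; exists (r + q).
    by rewrite mulrDr opprD addrACA; apply: SD.
  by move=> u q [r ur]; exists (r * q); rewrite mulrA -mulrBl; apply: SM.
- by exists (I a0), a0.
apply/Sa/SS => y yS; apply: socle_typed.
have [->|/eqP ya] := eqVneq (y * a) 0; [by left|right; split=> //; split=> // c yac].
have [|z [r zr]||d acd] := minI (I (a * c)) _ _ a.
- exists (a * c) => // Sac; move/eqP: yac; apply.
  by rewrite -mulrA; apply: yS.
- by exists (c * r); rewrite mulrA.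
- by exists 1; rewrite mulr1 subrr.
exists d; apply/eqP; rewrite eq_sym -subr_eq0; apply/eqP.
by rewrite -!mulrA -mulrBr mulrA; apply: yS.
Qed.

(** Induction on the [S n] containing [I]: multiplication by the elements [xs] with annihilator
    [S n] sends [I] into the finitely generated socle, and the kernel lies in [S n]. *)
Lemma right_noetherian (I : set R) : right_ideal I -> finitely_generated I.
Proof.
have [n Sn] := S_exhausts; have : I `<=` S n by rewrite Sn.
elim: n {Sn} I => [|n IH] I IS rI.
  by exists [::] => // a /IS.
have [rS _] := S_two_sided n; have [xs Hxs] := CF_annihilator CF rS.
have [l ml sl] := socle_fg.
apply: (@finitely_generated_lift R I xs rI) => [x xxs|].
  exists l => // a /IS Sa; apply/sl/Sa => q Sq.
  exact: (Hxs q).1.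
apply: IH => [a [_ /Hxs]//|]; case: rI => [I0 ID IM].
split=> [|a b [Ia xa] [Ib xb]|a r [Ia xa]].
- by split=> // x _; rewrite mulr0.
- by split=> [|x xxs]; [exact: ID|rewrite mulrDr xa // xb // addr0].
- by split=> [|x xxs]; [exact: IM|rewrite mulrA xa // mul0r].
Qed.

(** The right annihilators of the chain increase to a finitely generated right ideal [U], so they
    reach it at some stage; the terms of the chain are recovered as left annihilators. *)
Lemma left_artinian_of_baer : baer R -> left_artinian R.
Proof.
move=> baerR N sN Nd.
have lN n : left_ideal (fun a : R => a \in N n).
  have [N0 NZ] := sN n; split=> // [a b Na Nb|r a Na].
    by have := NZ 1 a b Na Nb; rewrite scale1r.
  by have := NZ r a 0 Na N0; rewrite addr0.
have Nle : forall m n, (m <= n)%N ->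
    (fun a : R => a \in N n) `<=` (fun a : R => a \in N m).
  by apply: decreasing_le => n a; apply: Nd.
pose U : set R := fun c => exists n, forall u : R, u \in N n -> u * c = 0.
have [|t tU Ut] := @right_noetherian U.
  split=> [|a b [m ma] [n nb]|a r [m ma]].
  - by exists 0%N => u _; rewrite mulr0.
  - exists (maxn m n) => u Nu; rewrite mulrDr ma ?nb ?addr0 //.
      by apply: Nle Nu; rewrite leq_maxr.
    by apply: Nle Nu; rewrite leq_maxl.
  - by exists m => u Nu; rewrite mulrA ma // mul0r.
have [n nt] : exists n, forall x, x \in t -> forall u : R, u \in N n -> u * x = 0.
  elim: t tU {Ut} => [|x t IH] tU; first by exists 0%N.
  have [|n nt] := IH; first by move=> y yt; apply: tU; rewrite in_cons yt orbT.
  have [m mx] := tU x (mem_head _ _); exists (maxn m n) => y.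
  rewrite in_cons => /predU1P[->|yt] u Nu.
    by apply: mx; apply: Nle Nu; rewrite leq_maxl.
  by apply: (nt y yt); apply: Nle Nu; rewrite leq_maxr.
exists n => k nk a; apply/idP/idP => [|Na]; first exact: (Nle _ _ nk).
apply: (annihilator_left baerR artR (lN k)) => c kc.
have Uc : U c by exists k.
have rI : right_ideal (fun c => a * c = 0).
  split=> [|u v au av|u r au]; first exact: mulr0.
    by rewrite mulrDr au av addr0.
  by rewrite mulrA au mul0r.
by apply: (rspan_min rI _ (Ut c Uc)) => x /nt/(_ a Na).
Qed.

End Noetherian.

Theorem corollary3p5 (R : pzRingType) :
  (right_CF R ->
   completely_right_T_nilpotent_radical (singular_quotient R) ->
   right_artinian R)
  /\
  (right_FGF R ->
   completely_right_T_nilpotent_radical (singular_quotient R) ->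
   quasi_Frobenius R).
Proof.
split; first exact: right_artinian_of_CF.
move=> FGF hT; have CF := FGF_CF FGF.
have artR := right_artinian_of_CF CF hT.
have baerR := FGF_baer FGF artR hT.
split=> //; [exact: baer_injective|exact: baer_cogenerator|].
by apply: left_artinian_of_baer => //; apply: socle_finitely_spanned.
Qed.
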